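(* Let $X$ be a smooth projective variety over $\mathbb{C}$, $X_2$ a primitive double scheme with support $X$ and associated line bundle $L$, and suppose that $L=\mathcal{I}_{X,X_2}$ can be extended to a line bundle $\mathbb{L}$ on $X_2$. Let $(U_i)$ be an affine open cover of $X$ such that the pair $(X_2,\mathbb{L})$ is described by the cocycle $\big((\Phi_{D_{ij},\alpha_{ij}},\alpha_{ij}+\beta_{ij}t)\big)$ of the sheaf of groups $\mathcal{H}_2$, where $D_{ij}$ is a derivation of $\mathcal{O}_X(U_{ij})$, $\alpha_{ij},\beta_{ij}\in\mathcal{O}_X(U_{ij})$ and $\alpha_{ij}$ is invertible; let $\eta\in H^1(X,\mathcal{H}_2)$ be its class. Let $\Delta''_2(\eta)\in H^2(X,T_X\otimes L^2)$ be the obstruction to the existence of a primitive multiple scheme $X_3$ of multiplicity $3$ extending $X_2$ with $\mathcal{I}_{X,X_3}=\mathbb{L}$. Then $\Delta''_2(\eta)$ is represented by the cocycle $(\rho_{ijk})$, where $$\rho_{ijk}=\frac{1}{2}\Big(\beta_{ij}D_{jk}+\Big(D_{jk}(\alpha_{ij})+\frac{\alpha_{ij}}{\alpha_{jk}}D_{jk}(\alpha_{jk})-\frac{\alpha_{ij}}{\alpha_{jk}}\beta_{jk}\Big)D_{ij}+\alpha_{ij}(D_{ij}D_{jk}-D_{jk}D_{ij})\Big).$$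
   Context: Primitive multiple schemes. A primitive multiple scheme with support $X$ ($X$ smooth connected of dimension $d$) is a Cohen-Macaulay scheme $Y$ over $\mathbb{C}$ with $Y_{red}=X$ such that every closed point of $X$ has a neighbourhood in $Y$ which is a locally closed subscheme of a smooth variety of dimension $d+1$. Its multiplicity is the smallest $n$ with $\mathcal{I}_X^n=0$, where $\mathcal{I}_X=\mathcal{I}_{X,Y}$ is the ideal sheaf of $X$ in $Y$ (double scheme: $n=2$); its associated line bundle is $L=\mathcal{I}_X/\mathcal{I}_X^2$. $\mathcal{I}_{X,Y}$ is a line bundle on the closed subscheme with ideal $\mathcal{I}_X^{n-1}$. $X_3$ extends $X_2$ if the closed subscheme of $X_3$ with ideal $\mathcal{I}_X^2$ is (isomorphic to) $X_2$. Sheaves of groups. For an open $U\subset X$, $\mathcal{G}_n(U)$ is the group of automorphisms of the $\mathbb{C}$-algebra $\mathcal{O}_X(U)[t]/(t^n)$ inducing the identity on $\mathcal{O}_X(U)=\big(\mathcal{O}_X(U)[t]/(t^n)\big)/(t)$. Primitive multiple schemes of multiplicity $n$ with support $X$ are locally isomorphic to $U\times\mathrm{Spec}(\mathbb{C}[t]/(t^n))$: with trivializations $\delta_i$ over an open cover $(U_i)$ and $\delta_{ij}^*=\delta_i^{*-1}\delta_j^*\in\mathcal{G}_n(U_{ij})$, the cocycle $(\delta_{ij}^* )$ (so $\delta^*_{ij}\delta^*_{jk}=\delta^*_{ik}$) describes the scheme. $\mathcal{H}_n(U)$ is the set of pairs $(\phi,u)$ with $\phi\in\mathcal{G}_n(U)$,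 $u\in\mathcal{O}_X(U)[t]/(t^n)$, $\phi(t)=ut$, with product $(\phi',u')(\phi,u)=(\phi'\phi,u'\phi'(u))$. $H^1(X,\mathcal{H}_n)$ is identified with the set of isomorphism classes of pairs $(X_n,\mathbb{L})$, with $X_n$ primitive of multiplicity $n$ with support $X$ and $\mathbb{L}$ a line bundle on $X_n$ extending $\mathcal{I}_{X,X_n}$: for a cocycle $((\phi_{ij},u_{ij}))$, $(\phi_{ij})$ is the cocycle of $\mathcal{G}_n$ describing $X_n$ and $(\delta_i^*(u_{ij}))$ is the cocycle of $\mathbb{L}$. For $D$ a derivation of $\mathcal{O}_X(U)$ and $\mu\in\mathcal{O}_X(U)$ invertible, $\Phi_{D,\mu}\in\mathcal{G}_2(U)$ is the automorphism with $\Phi_{D,\mu}(f)=f+D(f)t$ for $f\in\mathcal{O}_X(U)$ and $\Phi_{D,\mu}(t)=\mu t$. In the setting of the claim, $(\alpha_{ij})$ is a cocycle defining $L$ (via trivializations of $L$ on the $U_i$) and $D_{ik}=D_{ij}+\alpha_{ij}D_{jk}$. The obstruction. Let $\tau_2:\mathcal{G}_3\to\mathcal{H}_2$ be the morphism sending $\phi$, with $\phi(t)=ut$, to ($\phi$ mod $t^2$, $u$ mod $t^2$). It is surjective, with kernel isomorphic to $T_X$ (a derivation $D$ corresponds to $f\mapsto f+D(f)t^2$, $t\mapsto t$), and conjugation by a lift of a section $(\phi,u)$ of $\mathcal{H}_2$ acts on this kernel as multiplication by $u_0^2$, where $u_0$ is the constant term of $u$; hence the sheaf $T_X$ twisted by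 $\eta$ is $T_X\otimes L^2$. For a cocycle $(h_{ij})$ representing $\eta$, choose lifts $g_{ij}\in\mathcal{G}_3(U_{ij})$ of $h_{ij}$ with $g_{ji}=g_{ij}^{-1}$; $\Delta''_2(\eta)$ is the class of $(g_{ij}g_{jk}g_{ki})$, seen as a family of sections of $T_X$ on the $U_{ijk}$. Here and in the claim, a family $(\rho_{ijk})$, $\rho_{ijk}\in H^0(U_{ijk},T_X)$, with $\alpha_{ij}^2\rho_{jkl}-\rho_{ikl}+\rho_{ijl}-\rho_{ijk}=0$, represents the element of $H^2(X,T_X\otimes L^2)$ given by the true cocycle obtained by viewing $\rho_{ijk}$ as a section of $T_X\otimes L^2$ by means of the trivialization of $L$ on $U_i$. *)

(* Defs.v *)
(* The complex numbers are R[i] for R : realType.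

   Varieties are taken in the classical sense: the points are the closed points,
   with the Zariski topology, and schemes with support X are given by sheaves of
   algebras on X.  A sheaf is only recorded on nonempty open sets (its value on
   the empty set, the zero ring, is not a MathComp algebra); values and
   restrictions outside this range are junk, and every condition below is
   guarded by osub.  A section over U of a sheaf of endomorphisms (vector fields,
   automorphisms of O_X[t]/(t^n)) is a family of maps indexed by all sets V, of
   which only the members with osub V U matter. *)
From HB Require Import structures.
From Stdlib Require Import Relation_Operators.
From mathcomp Require Import all_boot all_order all_algebra.
From mathcomp Require Import all_classical all_reals topology.
From mathcomp Require Import complex.
From mathcomp Require mpoly.

Set Implicit Arguments.
Unset Strict Implicit.
Unset Printing Implicit Defensive.

Import GRing.Theory.
Local Open Scope ring_scope.
Local Open Scope classical_set_scope.

Definition osub (X : topologicalType) (V U : set X) : Prop :=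
  [/\ open V, V !=set0 & V `<=` U].

Definition open_cover (X : topologicalType) (I : Type) (U : I -> set X) : Prop :=
  (forall i, open (U i)) /\ (forall x, exists i, U i x).

Record algSheaf (K : fieldType) (X : topologicalType) := AlgSheaf {
  asec :> set X -> comUnitAlgType K;
  ares : forall U V : set X, asec U -> asec V;
  ares_morph : forall U V, open U -> osub V U ->
    linear (@ares U V) /\ monoid_morphism (@ares U V);
  ares_id : forall U, osub U U -> forall a, @ares U U a = a;
  ares_comp : forall U V W, open U -> osub V U -> osub W V ->
    forall a, @ares V W (@ares U V a) = @ares U W a;
  ares_glue : forall (I : Type) (V : I -> set X) (a : forall i, asec (V i)),
    (forall i, osub (V i) (V i)) -> (\bigcup_i V i) !=set0 ->
    (forall i j W, osub W (V i `&` V j) ->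
       @ares (V i) W (a i) = @ares (V j) W (a j)) ->
    exists! b : asec (\bigcup_i V i),
      forall i, @ares (\bigcup_i V i) (V i) b = a i }.

Arguments ares {K X} A U V _ : rename.

Record modSheaf (K : fieldType) (X : topologicalType) (A : algSheaf K X) :=
  ModSheaf {
  msec :> forall U : set X, lmodType (A U);
  mres : forall U V : set X, msec U -> msec V;
  mres_morph : forall U V, open U -> osub V U -> forall (a : A U) (m m' : msec U),
    @mres U V (a *: m + m') = ares A U V a *: @mres U V m + @mres U V m';
  mres_id : forall U, osub U U -> forall m, @mres U U m = m;
  mres_comp : forall U V W, open U -> osub V U -> osub W V ->
    forall m, @mres V W (@mres U V m) = @mres U W m;
  mres_glue : forall (I : Type) (V : I -> set X) (m : forall i, msec (V i)),
    (forall i, osub (V i) (V i)) -> (\bigcup_i V i) !=set0 ->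
    (forall i j W, osub W (V i `&` V j) ->
       @mres (V i) W (m i) = @mres (V j) W (m j)) ->
    exists! b : msec (\bigcup_i V i),
      forall i, @mres (\bigcup_i V i) (V i) b = m i }.

Arguments mres {K X A} M U V _ : rename.

Section LineBundles.
Variables (K : fieldType) (X : topologicalType) (A : algSheaf K X).

Definition frame (M : modSheaf A) (U : set X) (e : M U) : Prop :=
  forall V, osub V U -> bijective (fun a : A V => a *: mres M U V e).

Definition line_bundle (M : modSheaf A) : Prop :=
  forall x, exists (U : set X) (e : M U), [/\ open U, U x & frame e].

End LineBundles.

Section Varieties.
Variables (R : realType) (X : topologicalType) (O : algSheaf R[i] X).
Let C : fieldType := R[i].

Definition evalp n (v : 'rV[C]_n) (p : mpoly.mpoly n C) : C :=
  mpoly.meval (fun i => v 0 i) p.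

Definition homogeneous n d (p : mpoly.mpoly n C) : Prop :=
  forall m, mpoly.mcoeff m p != 0 -> mpoly.mdeg m = d.

(* The open subspace U of X is parametrised by Z through pi; its open subsets
   are the complements of zero sets, and the sections of O over V are the
   functions on V that are locally fractions P / Q with adm P Q. *)
Definition fraction_model (U : set X) n (Z : set 'rV[C]_n) (pi : 'rV[C]_n -> X)
    (adm : mpoly.mpoly n C -> mpoly.mpoly n C -> Prop) : Prop :=
  [/\ pi @` Z = U,
      forall V, V `<=` U ->
        (open V <-> exists T : set (mpoly.mpoly n C),
           (forall p, T p -> adm p p) /\
           (forall v, Z v -> (V (pi v) <-> exists2 p, T p & evalp v p != 0)))
    & exists ev : forall V : set X, O V -> X -> C, forall V, osub V U ->
      [/\ forall x, V x ->
            [/\ forall (c : C) f g, ev V (c *: f + g) x = c * ev V f x + ev V g x,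
                ev V 1 x = 1
              & forall f g, ev V (f * g) x = ev V f x * ev V g x],
          forall f g, (forall x, V x -> ev V f x = ev V g x) -> f = g,
          forall W, osub W V -> forall f x, W x -> ev W (ares O V W f) x = ev V f x
        & forall h : X -> C,
            (exists f, forall x, V x -> ev V f x = h x) <->
            (forall v, Z v -> V (pi v) -> exists P Q W,
               [/\ adm P Q, osub W V, W (pi v)
                 & forall w, Z w -> W (pi w) ->
                     evalp w Q != 0 /\ h (pi w) = evalp w P / evalp w Q])]].

Definition affine_open (U : set X) : Prop :=
  open U /\
  exists n (S : set (mpoly.mpoly n C)) (pi : 'rV[C]_n -> X),
    let Z := [set v | forall p, S p -> evalp v p = 0] in
    (forall v w, Z v -> Z w -> pi v = pi w -> v = w) /\
    fraction_model U Z pi (fun _ _ => True).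

Definition irreducible_closed (F : set X) : Prop :=
  [/\ closed F, F !=set0
    & forall A B : set X, closed A -> closed B ->
        F `<=` A `|` B -> F `<=` A \/ F `<=` B].

Definition irreducible_chain (d : nat) : Prop :=
  exists F : nat -> set X,
    (forall i, (i <= d)%N -> irreducible_closed (F i)) /\
    (forall i, (i < d)%N -> F i `<=` F i.+1 /\ F i <> F i.+1).

Definition krull_dim (d : nat) : Prop :=
  irreducible_chain d /\ ~ irreducible_chain d.+1.

(* Z is the cone, without its vertex, over a closed subvariety of P^N.  Smoothness
   is the Jacobian criterion on the cone: the tangent space of the cone at each
   of its points has dimension dim X + 1. *)
Definition smooth_projective_variety : Prop :=
  exists N (S : set (mpoly.mpoly N.+1 C)) (pi : 'rV[C]_N.+1 -> X) (d : nat),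
    let Z := [set v | v != 0 /\ forall p, S p -> evalp v p = 0] in
    [/\ forall p, S p -> exists k, homogeneous k p,
        forall v w, Z v -> Z w ->
          (pi v = pi w <-> exists2 c : C, c != 0 & w = c *: v),
        fraction_model setT Z pi
          (fun P Q => exists k, homogeneous k P /\ homogeneous k Q),
        irreducible_closed setT /\ krull_dim d
      & forall v, Z v -> exists T : {vspace 'rV[C]_N.+1},
          \dim T = d.+1 /\
          forall w, w \in T <->
            forall p, (forall z, Z z -> evalp z p = 0) ->
              \sum_i evalp v (mpoly.mderiv i p) * w 0 i = 0].

End Varieties.

Section VectorFields.
Variables (K : fieldType) (X : topologicalType) (O : algSheaf K X).

Definition vfield := forall V : set X, O V -> O V.

(* D is a section of T_X = Der_K(O_X) over U. *)
Definition is_vfield (U : set X) (D : vfield) : Prop :=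
  forall V, osub V U ->
    [/\ linear (D V),
        forall f g, D V (f * g) = f * D V g + g * D V f
      & forall W, osub W V -> forall f, ares O V W (D V f) = D W (ares O V W f)].

Definition eq_vfield (U : set X) (D D' : vfield) : Prop :=
  forall V, osub V U -> forall f, D V f = D' V f.

Definition vadd (D D' : vfield) : vfield := fun V f => D V f + D' V f.

Definition vscale (U : set X) (a : O U) (D : vfield) : vfield :=
  fun V f => ares O U V a * D V f.

End VectorFields.

Notation trunc A n := {poly %/ ('X^n : {poly A})}.

Section Truncated.
Variables (A : comNzRingType) (n : nat).

Definition tmk (p : {poly A}) : trunc A n := in_qpoly 'X^n p.
Definition tC (a : A) : trunc A n := tmk a%:P.
Definition tX : trunc A n := tmk 'X.
Definition tcoef (p : trunc A n) (i : nat) : A := (p : {poly A})`_i.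
Definition tcut (m : nat) (p : trunc A n) : trunc A m :=
  in_qpoly 'X^m (p : {poly A}).

End Truncated.

Arguments tmk {A} n p.
Arguments tC {A} n a.
Arguments tX {A} n.

Section Groups.
Variables (K : fieldType) (X : topologicalType) (O : algSheaf K X).

Definition tres n (U V : set X) (p : trunc (O U) n) : trunc (O V) n :=
  tmk n (map_poly (ares O U V) (p : {poly O U})).

Definition taut n := forall V : set X, trunc (O V) n -> trunc (O V) n.

Definition in_G n (U : set X) (phi : taut n) : Prop :=
  forall V, osub V U ->
    [/\ bijective (phi V),
        zmod_morphism (phi V) /\ monoid_morphism (phi V),
        forall (c : K) p, phi V (c%:A *: p) = c%:A *: phi V p,
        forall p, tcoef (phi V p) 0 = tcoef p 0
      & forall W, osub W V -> forall p, tres W (phi V p) = phi W (tres W p)].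

Definition in_H n (U : set X) (phi : taut n) (u : trunc (O U) n) : Prop :=
  in_G U phi /\ forall V, osub V U -> phi V (tX n) = tres V u * tX n.

Definition is_cocycleH n (I : Type) (U : I -> set X) (phi : I -> I -> taut n)
    (u : forall i j, trunc (O (U i `&` U j)) n) : Prop :=
  (forall i j, in_H (phi i j) (u i j)) /\
  forall i j k V, osub V (U i `&` U j `&` U k) ->
    (forall p, phi i j V (phi j k V p) = phi i k V p) /\
    tres V (u i j) * phi i j V (tres V (u j k)) = tres V (u i k).

Definition Phi (U : set X) (D : vfield O) (mu : O U) : taut 2 :=
  fun V p => tC 2 (tcoef p 0) +
             (D V (tcoef p 0) + ares O U V mu * tcoef p 1) *: tX 2.

(* tau_2 g = (phi, u) over U. *)
Definition tau2_eq (U : set X) (g : taut 3) (phi : taut 2) (u : trunc (O U) 2) :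
    Prop :=
  forall V, osub V U ->
    (forall p, tcut 2 (g V p) = phi V (tcut 2 p)) /\
    exists w : trunc (O V) 3, g V (tX 3) = w * tX 3 /\ tcut 2 w = tres V u.

(* gam is the element of the kernel of tau_2 associated with the section rho
   of T_X. *)
Definition kernel_elt (U : set X) (gam : taut 3) (rho : vfield O) : Prop :=
  is_vfield U rho /\
  forall V, osub V U ->
    (forall f, gam V (tC 3 f) = tC 3 f + rho V f *: tX 3 ^+ 2) /\
    gam V (tX 3) = tX 3.

End Groups.

(* The structure sheaf tB of a scheme with support X, together with the
   restriction map tpr : tB -> O_X; its kernel has square zero, and is
   identified through tiota with the O_X-module tL. *)
Record thickening (K : fieldType) (X : topologicalType) (O : algSheaf K X) :=
  Thickening {
  tB : algSheaf K X;
  tpr : forall V : set X, tB V -> O V;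
  tL : modSheaf O;
  tiota : forall V : set X, tL V -> tB V;
  tpr_morph : forall V, osub V setT -> linear (@tpr V) /\ monoid_morphism (@tpr V);
  tpr_res : forall V W, open V -> osub W V ->
    forall b, @tpr W (ares tB V W b) = ares O V W (@tpr V b);
  tpr_surj : forall V, open V -> forall (f : O V) x, V x ->
    exists W, [/\ osub W V, W x & exists b : tB W, @tpr W b = ares O V W f];
  tiota_add : forall V, osub V setT -> zmod_morphism (@tiota V);
  tiota_scale : forall V, osub V setT -> forall b l,
    @tiota V (@tpr V b *: l) = b * @tiota V l;
  tiota_res : forall V W, open V -> osub W V ->
    forall l, @tiota W (mres tL V W l) = ares tB V W (@tiota V l);
  tiota_inj : forall V, osub V setT -> injective (@tiota V);
  tiota_ker : forall V, osub V setT -> forall b,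
    @tpr V b = 0 <-> exists l, b = @tiota V l }.

Arguments tpr {K X O} Y {V} b : rename.
Arguments tiota {K X O} Y {V} l : rename.

Section DoubleSchemes.
Variables (K : fieldType) (X : topologicalType) (O : algSheaf K X).
Variable Y : thickening O.

(* del is the isomorphism O_U[t]/(t^2) -> O_Y|U written delta^*. *)
Definition trivialization (U : set X)
    (del : forall V : set X, trunc (O V) 2 -> tB Y V) : Prop :=
  forall V, osub V U ->
    [/\ bijective (del V),
        zmod_morphism (del V) /\ monoid_morphism (del V),
        forall (c : K) p, del V (c%:A *: p) = c *: del V p,
        forall p, tpr Y (del V p) = tcoef p 0
      & forall W, osub W V ->
          forall p, ares (tB Y) V W (del V p) = del W (tres W p)].

(* Local form of a primitive scheme of multiplicity 2 with smooth support X: such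
   a scheme is locally isomorphic to U x Spec K[t]/(t^2), and conversely the latter
   is Cohen-Macaulay and embedded in the smooth variety U x A^1. *)
Definition primitive_double : Prop :=
  forall x, exists (U : set X) del, [/\ open U, U x & @trivialization U del].

(* q identifies the restriction LL / I_X LL of LL to X with L = I_X. *)
Definition is_extension (LL : modSheaf (tB Y))
    (q : forall V : set X, LL V -> tL Y V) : Prop :=
  forall V, osub V setT ->
    [/\ forall (b : tB Y V) m m', q V (b *: m + m') = tpr Y b *: q V m + q V m',
        forall W, osub W V -> forall m, mres (tL Y) V W (q V m) = q W (mres LL V W m),
        forall m, q V m = 0 <->
          (forall x, V x -> exists W, [/\ osub W V, W x
             & exists (b : tB Y W) m', tpr Y b = 0 /\ mres LL V W m = b *: m'])
      & forall l x, V x -> exists W, [/\ osub W V, W x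
             & exists m, q W m = mres (tL Y) V W l]].

(* The pair (Y, LL) is described by the cocycle (phi, u): del_i are
   trivializations of Y with phi_ij = del_i^-1 del_j, e_i = del_i(t) the
   resulting frames of L, and s_i frames of LL lifting the e_i, with
   s_j = del_i(u_ij) s_i. *)
Definition described_by (LL : modSheaf (tB Y))
    (q : forall V : set X, LL V -> tL Y V) (I : Type) (U : I -> set X)
    (phi : I -> I -> taut O 2) (u : forall i j, trunc (O (U i `&` U j)) 2)
    (del : I -> forall V : set X, trunc (O V) 2 -> tB Y V)
    (e : forall i, tL Y (U i)) (s : forall i, LL (U i)) : Prop :=
  [/\ forall i, trivialization (U i) (del i),
      forall i, frame (s i),
      forall i V, osub V (U i) ->
        tiota Y (mres (tL Y) (U i) V (e i)) = del i V (tX 2) /\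
        q V (mres LL (U i) V (s i)) = mres (tL Y) (U i) V (e i)
    & forall i j V, osub V (U i `&` U j) ->
        (forall p, del i V (phi i j V p) = del j V p) /\
        mres LL (U j) V (s j) =
          del i V (tres V (u i j)) *: mres LL (U i) V (s i)].

End DoubleSchemes.

Section Tensor.
Variables (K : fieldType) (X : topologicalType) (O : algSheaf K X).
Variable L : modSheaf O.

Definition trilinear (F : modSheaf O)
    (mt : forall V : set X, vfield O -> L V -> L V -> F V) : Prop :=
  forall V, osub V setT -> forall D D' : vfield O, is_vfield V D -> is_vfield V D' ->
    [/\ forall l l', eq_vfield V D D' -> mt V D l l' = mt V D' l l',
        forall (a : O V) l l',
          mt V (vadd (vscale a D) D') l l' = a *: mt V D l l' + mt V D' l l',
        forall (a : O V) l m l', mt V D (a *: l + m) l' = a *: mt V D l l' + mt V D m l',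
        forall (a : O V) l l' m, mt V D l (a *: l' + m) = a *: mt V D l l' + mt V D l m
      & forall W, osub W V -> forall l l',
          mres F V W (mt V D l l') = mt W D (mres L V W l) (mres L V W l')].

Definition mod_morphism (F G : modSheaf O) (h : forall V : set X, F V -> G V) : Prop :=
  forall V, osub V setT ->
    linear (h V) /\
    forall W, osub W V -> forall y, mres G V W (h V y) = h W (mres F V W y).

(* (F, mt) has the universal property of T_X (x) L^2 in O_X-module sheaves. *)
Definition is_tensorTL2 (F : modSheaf O)
    (mt : forall V : set X, vfield O -> L V -> L V -> F V) : Prop :=
  trilinear mt /\
  forall (G : modSheaf O) (nt : forall V : set X, vfield O -> L V -> L V -> G V),
    trilinear nt ->
    let factors h := mod_morphism h /\
      forall V, osub V setT -> forall D l l', is_vfield V D ->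
        h V (mt V D l l') = nt V D l l' in
    (exists h, factors h) /\
    forall h h', factors h -> factors h' ->
      forall V, osub V setT -> forall y, h V y = h' V y.

(* A family (rho_ijk) of vector fields on the U_ijk, viewed as a 2-cochain of
   T_X (x) L^2 by means of the frame e_i of L on U_i. *)
Definition twist2 (F : modSheaf O)
    (mt : forall V : set X, vfield O -> L V -> L V -> F V)
    (I : Type) (U : I -> set X) (e : forall i, L (U i))
    (rho : I -> I -> I -> vfield O) (i j k : I) : F (U i `&` U j `&` U k) :=
  mt _ (rho i j k) (mres L (U i) _ (e i)) (mres L (U i) _ (e i)).

End Tensor.

Section Cech.
Variables (K : fieldType) (X : topologicalType) (O : algSheaf K X).
Variable F : modSheaf O.

Definition is_cocycle2 (I : Type) (U : I -> set X)
    (c : forall i j k, F (U i `&` U j `&` U k)) : Prop :=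
  forall i j k l V, osub V (U i `&` U j `&` U k `&` U l) ->
    mres F _ V (c j k l) - mres F _ V (c i k l) +
    mres F _ V (c i j l) - mres F _ V (c i j k) = 0.

Record cocycle2 := Cocycle2 {
  c2_ix : Type;
  c2_cov : c2_ix -> set X;
  c2_val : forall i j k, F (c2_cov i `&` c2_cov j `&` c2_cov k);
  c2_open : open_cover c2_cov;
  c2P : is_cocycle2 c2_val }.

Arguments c2_cov : clear implicits.
Arguments c2_val : clear implicits.

(* The covering of d refines that of c, and d is cohomologous to the
   pull-back of c. *)
Definition refined_cohomologous (c d : cocycle2) : Prop :=
  exists (r : c2_ix d -> c2_ix c)
         (z : forall i j, F (c2_cov d i `&` c2_cov d j)),
    (forall i, c2_cov d i `<=` c2_cov c (r i)) /\
    forall i j k V, osub V (c2_cov d i `&` c2_cov d j `&` c2_cov d k) ->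
      mres F _ V (c2_val d i j k) =
        mres F _ V (c2_val c (r i) (r j) (r k)) +
        (mres F _ V (z j k) - mres F _ V (z i k) + mres F _ V (z i j)).

(* H^2(X, F) is the colimit over open covers of the Cech groups: its elements
   are the equivalence classes of cocycles for the relation generated by
   refined_cohomologous.  This is the usual H^2 for F quasi-coherent on a
   separated X. *)
Definition H2class (c : cocycle2) : set cocycle2 :=
  [set d | clos_refl_sym_trans cocycle2 refined_cohomologous c d].

End Cech.

Arguments Cocycle2 {K X O F c2_ix c2_cov c2_val}.

Section Obstruction.
Variables (K : fieldType) (X : topologicalType) (O : algSheaf K X).
Variables (Y : thickening O) (LL : modSheaf (tB Y)).
Variable q : forall V : set X, LL V -> tL Y V.
Variables (F : modSheaf O) (mt : forall V : set X, vfield O -> tL Y V -> tL Y V -> F V).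

(* c is the cocycle of T_X (x) L^2 obtained from a cocycle (phi, u) of H_2
   representing the class eta of (Y, LL), and from lifts g_ij of it to G_3 with
   g_ji = g_ij^-1. *)
Definition obstruction_cocycle (c : cocycle2 F) : Prop :=
  exists (I : Type) (U : I -> set X) (phi : I -> I -> taut O 2)
    (u : forall i j, trunc (O (U i `&` U j)) 2)
    (del : I -> forall V : set X, trunc (O V) 2 -> tB Y V)
    (e : forall i, tL Y (U i)) (s : forall i, LL (U i))
    (g : I -> I -> taut O 3) (rho : I -> I -> I -> vfield O)
    (cov : open_cover U) (cP : is_cocycle2 (twist2 mt e rho)),
    [/\ is_cocycleH phi u /\ described_by q phi u del e s,
        forall i j, in_G (U i `&` U j) (g i j) /\ tau2_eq (g i j) (phi i j) (u i j),
        forall i j V, osub V (U i `&` U j) -> forall p, g i j V (g j i V p) = p,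
        forall i j k, kernel_elt (U i `&` U j `&` U k)
          (fun V p => g i j V (g j k V (g k i V p))) (rho i j k)
      & c = Cocycle2 cov cP].

(* Delta''_2(eta), as a set of cocycles: all those cohomologous to an
   obstruction cocycle. *)
Definition Delta2 : set (cocycle2 F) :=
  [set d | exists2 c, obstruction_cocycle c & H2class c d].

End Obstruction.

(* Main.v *)
(* Let (phi, u) be a section of H_2, with phi(f) = f + D(f) t and u = a + b t.
   Lifting it to G_3 by f |-> f + D(f) t + E(f) t^2, t |-> a t + b t^2 amounts to
   choosing an operator E with E(fg) = f E(g) + g E(f) + D(f) D(g).  As 2 is
   invertible, E = (D^2 + c D) / 2 is one for every function c; for
   c = (b - D(a)) / a the lifts of (phi, u) and of its inverse are inverse to each
   other, and g_ij g_jk g_ki is the element of the kernel given by the rho_ijk of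
   the theorem.

   Independence of the choices needs no common refinement: two descriptions of
   (X_2, LL), over covers indexed by I and I', form together a description over
   the disjoint union I + I', for which lifts exist on all overlaps, and the
   resulting cocycle pulls back to both given ones. *)
Require Import Defs.
From mathcomp Require Import all_boot all_order all_algebra.
From mathcomp Require Import all_classical all_reals topology.
From mathcomp Require Import complex.
From mathcomp Require Import ring.
From Stdlib Require Import Relation_Operators.

Set Implicit Arguments.
Unset Strict Implicit.
Unset Printing Implicit Defensive.

Import GRing.Theory.
Local Open Scope ring_scope.
Local Open Scope classical_set_scope.

(** * Coefficientwise computation in A[t]/(t^n) *)

Section TruncatedCoefficients.
Variable A : comNzRingType.
Implicit Types (a b c : A).

Lemma tcoef_tmk n (p : {poly A}) i :
  tcoef (tmk n.+1 p) i = if (i < n.+1)%N then p`_i else 0.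
Proof.
by rewrite /tcoef /tmk /in_qpoly /= mk_monic_Xn -Pdiv.RingMonic.take_poly_rmodp
           coef_take_poly.
Qed.

Lemma tcoef_tcut n m (p : trunc A n) i :
  tcoef (tcut m.+1 p) i = if (i < m.+1)%N then tcoef p i else 0.
Proof. exact: tcoef_tmk. Qed.

Lemma tcoef_ge n (p : trunc A n.+1) i : (n < i)%N -> tcoef p i = 0.
Proof.
move=> ni; rewrite /tcoef nth_default //; apply: leq_trans ni.
have e : size (mk_monic 'X^(n.+1) : {poly A}) = n.+2.
  by rewrite mk_monic_Xn size_polyXn.
by rewrite -ltnS -[X in (_ < X)%N]e size_mk_monic.
Qed.

Lemma truncP n (p q : trunc A n.+1) :
  (forall i, (i < n.+1)%N -> tcoef p i = tcoef q i) -> p = q.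
Proof.
move=> pq; apply/npolyP => i; case: (ltnP i n.+1) => [/pq //|ni].
by have := tcoef_ge p ni; have := tcoef_ge q ni; rewrite /tcoef => -> ->.
Qed.

Lemma trunc2P (p q : trunc A 2) :
  tcoef p 0 = tcoef q 0 -> tcoef p 1 = tcoef q 1 -> p = q.
Proof. by move=> e0 e1; apply: truncP => -[|[|]]. Qed.

Lemma trunc3P (p q : trunc A 3) :
  tcoef p 0 = tcoef q 0 -> tcoef p 1 = tcoef q 1 -> tcoef p 2 = tcoef q 2 ->
  p = q.
Proof. by move=> e0 e1 e2; apply: truncP => -[|[|[|]]]. Qed.

Lemma tcoefD n (p q : trunc A n) i : tcoef (p + q) i = tcoef p i + tcoef q i.
Proof. exact: coefD. Qed.

Lemma tcoefB n (p q : trunc A n) i : tcoef (p - q) i = tcoef p i - tcoef q i.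
Proof. exact: coefB. Qed.

Lemma tcoef0 n i : tcoef (0 : trunc A n) i = 0.
Proof. exact: coef0. Qed.

Lemma tcoef1 n i : @tcoef A n 1 i = (i == 0%N)%:R.
Proof. exact: coef1. Qed.

Lemma tcoefZ n a (p : trunc A n) i : tcoef (a *: p) i = a * tcoef p i.
Proof. exact: coefZ. Qed.

Lemma tcoefM n (p q : trunc A n.+1) i : (i < n.+1)%N ->
  tcoef (p * q) i = \sum_(j < i.+1) tcoef p j * tcoef q (i - j).
Proof.
move=> ni; have -> : p * q = tmk n.+1 ((p : {poly A}) * q) by [].
by rewrite tcoef_tmk ni coefM.
Qed.

Lemma tcoefM0 n (p q : trunc A n.+1) :
  tcoef (p * q) 0 = tcoef p 0 * tcoef q 0.
Proof. by rewrite tcoefM // big_ord1. Qed.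

Lemma tcoefM1 n (p q : trunc A n.+2) :
  tcoef (p * q) 1 = tcoef p 0 * tcoef q 1 + tcoef p 1 * tcoef q 0.
Proof. by rewrite tcoefM // !big_ord_recr big_ord0 /= add0r. Qed.

Lemma tcoefM2 n (p q : trunc A n.+3) :
  tcoef (p * q) 2 =
  tcoef p 0 * tcoef q 2 + tcoef p 1 * tcoef q 1 + tcoef p 2 * tcoef q 0.
Proof. by rewrite tcoefM // !big_ord_recr big_ord0 /= add0r. Qed.

Lemma tcoef_tC n a i : tcoef (tC n.+1 a) i = if i == 0%N then a else 0.
Proof. by rewrite tcoef_tmk coefC; case: i => [|i] //=; rewrite if_same. Qed.

Lemma tcoef_tX n i : tcoef (@tX A n.+2) i = (i == 1%N)%:R.
Proof. by rewrite tcoef_tmk coefX; case: i => [|[|i]] //=; rewrite if_same. Qed.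

Definition tcoefE := (tcoefD, tcoefB, tcoefZ, tcoef_tcut, tcoefM0, tcoefM1,
  tcoefM2, tcoef0, tcoef1, tcoef_tC, tcoef_tX).

Lemma trunc2E (p : trunc A 2) : p = tC 2 (tcoef p 0) + tC 2 (tcoef p 1) * tX 2.
Proof. by apply: trunc2P; rewrite !tcoefE /=; ring. Qed.

Lemma trunc3E (p : trunc A 3) :
  p = tC 3 (tcoef p 0) + tC 3 (tcoef p 1) * tX 3
      + tC 3 (tcoef p 2) * (tX 3 * tX 3).
Proof. by apply: trunc3P; rewrite !tcoefE /=; ring. Qed.

Lemma tCD n a b : tC n.+1 (a + b) = tC n.+1 a + tC n.+1 b.
Proof. by apply: truncP => i _; rewrite !tcoefE; case: eqP; rewrite ?addr0. Qed.

Lemma tCM n a b : tC n (a * b) = tC n a * tC n b.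
Proof. by rewrite /tC /tmk polyCM rmorphM. Qed.

Lemma tCZ n a b : tC n (a * b) = a *: tC n b.
Proof. by rewrite /tC /tmk polyCM mul_polyC linearZ. Qed.

End TruncatedCoefficients.

(** * Additive and linear maps, nonempty open subsets *)

Section Morphisms.

Lemma addr_self_eq0 (M : zmodType) (x : M) : x = x + x -> x = 0.
Proof. by move=> e; apply: (@addrI _ x); rewrite addr0 -e. Qed.

Lemma linear_fD (K : pzRingType) (M N : lmodType K) (f : M -> N) :
  linear f -> {morph f : x y / x + y}.
Proof. by move=> lf x y; rewrite -[x]scale1r lf !scale1r. Qed.

Lemma linear_f0 (K : pzRingType) (M N : lmodType K) (f : M -> N) :
  linear f -> f 0 = 0.
Proof. by move=> lf; apply: (@addrI _ (f 0)); rewrite -linear_fD // !addr0. Qed.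

Lemma linear_fZ (K : pzRingType) (M N : lmodType K) (f : M -> N) :
  linear f -> forall c x, f (c *: x) = c *: f x.
Proof.
by move=> lf c x; rewrite -[c *: x]addr0 lf (linear_f0 lf) addr0.
Qed.

Lemma linear_fN (K : pzRingType) (M N : lmodType K) (f : M -> N) :
  linear f -> {morph f : x / - x}.
Proof. by move=> lf x; rewrite -scaleN1r (linear_fZ lf) scaleN1r. Qed.

Lemma zmod_f0 (M N : zmodType) (f : M -> N) : zmod_morphism f -> f 0 = 0.
Proof. by move=> zf; rewrite -[X in f X](subrr 0) zf subrr. Qed.

Lemma zmod_fD (M N : zmodType) (f : M -> N) :
  zmod_morphism f -> {morph f : x y / x + y}.
Proof.
move=> zf x y; have fN z : f (- z) = - f z.
  by rewrite -[X in f X]sub0r zf (zmod_f0 zf) sub0r.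
by rewrite -[X in f (x + X)]opprK zf fN opprK.
Qed.

End Morphisms.

Lemma osub_trans (X : topologicalType) (U V W : set X) :
  osub V U -> osub W V -> osub W U.
Proof. by move=> [_ _ sVU] [oW W0 sWV]; split=> // x /sWV/sVU. Qed.

Lemma osub_subset (X : topologicalType) (U V W : set X) :
  osub W V -> V `<=` U -> osub W U.
Proof. by move=> [oW W0 sWV] sVU; split=> // x /sWV/sVU. Qed.

(** * Restriction maps of sheaves of algebras and of modules *)

Section Restrictions.
Variables (K : fieldType) (X : topologicalType) (O : algSheaf K X).
Variables (U V : set X).
Hypotheses (oU : open U) (sVU : osub V U).

Lemma aresD : {morph ares O U V : f g / f + g}.
Proof. exact: linear_fD (ares_morph O oU sVU).1. Qed.

Lemma aresN : {morph ares O U V : f / - f}.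
Proof. exact: linear_fN (ares_morph O oU sVU).1. Qed.

Lemma aresB : {morph ares O U V : f g / f - g}.
Proof. by move=> f g; rewrite aresD aresN. Qed.

Lemma ares0 : ares O U V 0 = 0.
Proof. exact: linear_f0 (ares_morph O oU sVU).1. Qed.

Lemma aresZ c f : ares O U V (c *: f) = c *: ares O U V f.
Proof. exact: linear_fZ (ares_morph O oU sVU).1 c f. Qed.

Lemma aresM : {morph ares O U V : f g / f * g}.
Proof. exact: (ares_morph O oU sVU).2.2. Qed.

Lemma ares1 : ares O U V 1 = 1.
Proof. exact: (ares_morph O oU sVU).2.1. Qed.

Lemma aresV f : f \is a GRing.unit -> ares O U V f^-1 = (ares O U V f)^-1.
Proof.
move=> uf; have e : ares O U V f * ares O U V f^-1 = 1.
  by rewrite -aresM divrr // ares1.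
have ur : ares O U V f \is a GRing.unit.
  by apply/unitrPr; exists (ares O U V f^-1).
by apply: (mulrI ur); rewrite e divrr.
Qed.

Lemma tcoef_tres n (p : trunc (O U) n.+1) i :
  tcoef (tres V p) i = ares O U V (tcoef p i).
Proof.
case: (ltnP i n.+1) => ni; last by rewrite !tcoef_ge // ares0.
by rewrite tcoef_tmk ni coef_map_id0 // ares0.
Qed.

Lemma tres_tC n f : tres V (tC n.+1 f) = tC n.+1 (ares O U V f).
Proof.
by apply: truncP => i _; rewrite tcoef_tres !tcoefE; case: eqP; rewrite ?ares0.
Qed.

End Restrictions.

Lemma mres0 (K : fieldType) (X : topologicalType) (A : algSheaf K X)
  (M : modSheaf A) (U V : set X) : open U -> osub V U -> mres M U V 0 = 0.
Proof.
move=> oU sVU; have := @mres_morph _ _ _ M _ _ oU sVU 1 0 0.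
rewrite scaler0 addr0 ares1 // scale1r => e.
by apply: (@addrI _ (mres M U V 0)); rewrite -e addr0.
Qed.

Lemma mresZ (K : fieldType) (X : topologicalType) (A : algSheaf K X)
  (M : modSheaf A) (U V : set X) : open U -> osub V U ->
  forall a m, mres M U V (a *: m) = ares A U V a *: mres M U V m.
Proof.
by move=> oU sVU a m; rewrite -[a *: m]addr0 mres_morph // mres0 // addr0.
Qed.

(** * Derivations and second-order jets over them *)

Section SecondOrder.
Variables (K : fieldType) (X : topologicalType) (O : algSheaf K X).

(** A section of O over U, encoded by its values on smaller open sets: the transition coefficients
    below are chosen separately on each open set. *)
Definition is_section (U : set X) (a : forall V, O V) : Prop :=
  forall V W, osub V U -> osub W V -> ares O V W (a V) = a W.

(* f |-> f + D(f) t + E(f) t^2 is a morphism of algebras to O_X[t]/(t^3). *)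
Definition is_jet (U : set X) (D E : vfield O) : Prop :=
  is_vfield U D /\
  forall V, osub V U ->
    [/\ linear (E V),
        forall f g, E V (f * g) = f * E V g + g * E V f + D V f * D V g
      & forall W, osub W V -> forall f,
          ares O V W (E V f) = E W (ares O V W f)].

Section Derivations.
Variables (U : set X) (D : vfield O).
Arguments D : clear implicits.
Hypothesis derD : is_vfield U D.
Variable V : set X.
Hypothesis sVU : osub V U.

Lemma vfieldD : {morph D V : f g / f + g}.
Proof. by case: (derD sVU) => /linear_fD. Qed.

Lemma vfieldN : {morph D V : f / - f}.
Proof. by case: (derD sVU) => /linear_fN. Qed.

Lemma vfieldZ c f : D V (c *: f) = c *: D V f.
Proof. by case: (derD sVU) => /linear_fZ. Qed.

Lemma vfieldM f g : D V (f * g) = f * D V g + g * D V f.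
Proof. by case: (derD sVU). Qed.

Lemma vfield0 : D V 0 = 0.
Proof. by case: (derD sVU) => /linear_f0. Qed.

Lemma vfield1 : D V 1 = 0.
Proof.
by apply: (@addrI _ (D V 1)); rewrite addr0 -{3}(mulr1 1) vfieldM !mul1r.
Qed.

Lemma vfield_res W : osub W V -> forall f, ares O V W (D V f) = D W (ares O V W f).
Proof. by case: (derD sVU) => _ _; apply. Qed.

End Derivations.

Section Jets.
Variables (U : set X) (D E : vfield O).
Arguments D : clear implicits.
Arguments E : clear implicits.
Hypothesis jetE : is_jet U D E.
Variable V : set X.
Hypothesis sVU : osub V U.

Lemma jetD : {morph E V : f g / f + g}.
Proof. by case: (jetE.2 _ sVU) => /linear_fD. Qed.

Lemma jetZ c f : E V (c *: f) = c *: E V f.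
Proof. by case: (jetE.2 _ sVU) => /linear_fZ. Qed.

Lemma jet0 : E V 0 = 0.
Proof. by case: (jetE.2 _ sVU) => /linear_f0. Qed.

Lemma jetM f g : E V (f * g) = f * E V g + g * E V f + D V f * D V g.
Proof. by case: (jetE.2 _ sVU). Qed.

Lemma jet_res W : osub W V -> forall f, ares O V W (E V f) = E W (ares O V W f).
Proof. by case: (jetE.2 _ sVU) => _ _; apply. Qed.

End Jets.

Lemma eq_vfieldP (U : set X) (D D' : vfield O) :
  eq_vfield U D D' -> is_vfield U D -> is_vfield U D'.
Proof.
move=> eD vD V sV; split=> [c f g|f g|W sW f].
- by rewrite -!eD // (vfieldD vD) // (vfieldZ vD).
- by rewrite -!eD // (vfieldM vD).
- by rewrite -!eD ?(vfield_res vD) //; exact: osub_trans sV sW.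
Qed.

Lemma is_vfieldS (U U' : set X) (D : vfield O) :
  U' `<=` U -> is_vfield U D -> is_vfield U' D.
Proof. by move=> sU vD V /osub_subset/(_ sU); exact: vD. Qed.

Lemma is_jetS (U U' : set X) (D E : vfield O) :
  U' `<=` U -> is_jet U D E -> is_jet U' D E.
Proof.
move=> sU [vD jE]; split; first exact: is_vfieldS vD.
by move=> V /osub_subset/(_ sU); exact: jE.
Qed.

Lemma is_sectionS (U U' : set X) (a : forall V, O V) :
  U' `<=` U -> is_section U a -> is_section U' a.
Proof. by move=> sU sa V W /osub_subset/(_ sU); exact: sa. Qed.

Lemma is_section_ares (U : set X) (a : O U) :
  open U -> is_section U (fun V => ares O U V a).
Proof. by move=> oU V W sV sW; rewrite ares_comp. Qed.

Lemma vfield_mul (U : set X) (a : forall V, O V) (D : vfield O) :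
  is_section U a -> is_vfield U D -> is_vfield U (fun V f => a V * D V f).
Proof.
move=> sa vD V sV; have oV : open V by case: sV.
split=> [c f g|f g|W sW f].
- by rewrite (vfieldD vD) // (vfieldZ vD) // mulrDr scalerAr.
- by rewrite (vfieldM vD) //; ring.
- by rewrite aresM // sa // (vfield_res vD).
Qed.

Lemma vfield_add (U : set X) (D D' : vfield O) :
  is_vfield U D -> is_vfield U D' -> is_vfield U (vadd D D').
Proof.
move=> vD vD' V sV; have oV : open V by case: sV.
rewrite /vadd; split=> [c f g|f g|W sW f].
- rewrite !(vfieldD vD, vfieldD vD') // !(vfieldZ vD, vfieldZ vD') //.
  by rewrite scalerDr addrACA.
- by rewrite (vfieldM vD) // (vfieldM vD') //; ring.
- by rewrite aresD // (vfield_res vD) // (vfield_res vD').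
Qed.

(** The square of [D] on a product has cross term twice [D f * D g]; halving leaves the cross term
    of a jet. *)
Lemma jet_half_square (U : set X) (D : vfield O) :
  2%:R != 0 :> K -> is_vfield U D ->
  is_jet U D (fun V f => 2%:R^-1 *: D V (D V f)).
Proof.
move=> n2 vD; split=> // V sV; have oV : open V by case: sV.
split=> [c f g|f g|W sW f].
- rewrite !(vfieldD vD, vfieldZ vD) // scalerDr; congr (_ + _).
  by rewrite !scalerA mulrC.
- rewrite !(vfieldM vD) // !(vfieldD vD) // !(vfieldM vD) // !scalerDr.
  rewrite -!scalerAr [D V g * _]mulrC.
  set x := _ *: (D V f * _); rewrite addrACA addrC; set y := _ + _.
  have -> : D V f * D V g = x + x.
    by rewrite /x -scalerDl -[_^-1]mul1r -mulrDl divff // scale1r.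
  by rewrite /y; ring.
- by rewrite aresZ // !(vfield_res vD).
Qed.

Lemma jet_add_vfield (U : set X) (D E D' : vfield O) :
  is_jet U D E -> is_vfield U D' -> is_jet U D (vadd E D').
Proof.
move=> jE vD'; split=> [|V sV]; first by case: jE.
have oV : open V by case: sV.
rewrite /vadd; split=> [c f g|f g|W sW f].
- rewrite !(jetD jE, vfieldD vD') // !(jetZ jE, vfieldZ vD') //.
  by rewrite scalerDr addrACA.
- by rewrite (jetM jE) // (vfieldM vD') //; ring.
- by rewrite aresD // (jet_res jE) // (vfield_res vD').
Qed.

(** The two operators are the coefficients of t and t^2 obtained by applying f |-> f + D1(f) t +
    E1(f) t^2, t |-> a t + b t^2 to f + D2(f) t + E2(f) t^2. *)
Lemma jet_comp (U : set X) (a b : forall V, O V) (D1 E1 D2 E2 : vfield O) :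
  is_section U a -> is_section U b -> is_jet U D1 E1 -> is_jet U D2 E2 ->
  is_jet U (fun V f => D1 V f + a V * D2 V f)
    (fun V f => E1 V f + a V * D1 V (D2 V f) + b V * D2 V f
                + a V ^+ 2 * E2 V f).
Proof.
move=> sa sb jE1 jE2; have [vD1 _] := jE1; have [vD2 _] := jE2.
split; first exact: vfield_add vD1 (vfield_mul sa vD2).
move=> V sV; have oV : open V by case: sV.
split=> [c f g|f g|W sW f].
- rewrite !(jetD jE1, jetD jE2, vfieldD vD1, vfieldD vD2,
    jetZ jE1, jetZ jE2, vfieldZ vD1, vfieldZ vD2) // !scalerDr !scalerAr; ring.
- rewrite (jetM jE1) // (jetM jE2) // (vfieldM vD2) // (vfieldD vD1) //.
  by rewrite !(vfieldM vD1) //; ring.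
- rewrite !(aresD, aresM, expr2) // sa // sb // (jet_res jE1) // (jet_res jE2) //.
  by rewrite !(vfield_res vD1, vfield_res vD2).
Qed.

(** Jets over the same derivation have the same cross term in their product rule, so it cancels in
    the difference. *)
Lemma jet_sub (U : set X) (D E D' E' : vfield O) :
  is_jet U D E -> is_jet U D' E' -> eq_vfield U D D' ->
  is_vfield U (fun V f => E V f - E' V f).
Proof.
move=> jE jE' eD V sV; have oV : open V by case: sV.
split=> [c f g|f g|W sW f].
- by rewrite !(jetD jE, jetD jE', jetZ jE, jetZ jE') // scalerBr; ring.
- by rewrite (jetM jE) // (jetM jE') // !eD //; ring.
- by rewrite aresB // (jet_res jE) // (jet_res jE').
Qed.

End SecondOrder.

(** * Trilinear maps on T_X, L, L *)

Section Trilinear.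
Variables (K : fieldType) (X : topologicalType) (O : algSheaf K X).
Variables (L F : modSheaf O).
Variable mt : forall V : set X, vfield O -> L V -> L V -> F V.
Arguments mt : clear implicits.
Hypothesis tri : trilinear mt.
Variable V : set X.
Hypothesis sVT : osub V setT.

Let oV : open V. Proof. by case: sVT. Qed.

Lemma mtZZ D (a : O V) l : is_vfield V D ->
  mt V D (a *: l) (a *: l) = a ^+ 2 *: mt V D l l.
Proof.
move=> vD; have [_ _ mtl mtr _] := tri sVT vD vD.
have mt0l l' : mt V D 0 l' = 0.
  by apply: addr_self_eq0; have := mtl 1 0 0 l'; rewrite scaler0 addr0 scale1r.
have mt0r l' : mt V D l' 0 = 0.
  by apply: addr_self_eq0; have := mtr 1 l' 0 0; rewrite scaler0 addr0 scale1r.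
rewrite -[X in mt V D X _]addr0 mtl mt0l addr0.
by rewrite -[X in mt V D _ X]addr0 mtr mt0r addr0 scalerA.
Qed.

Lemma vfield_scale (a : O V) D : is_vfield V D -> is_vfield V (vscale a D).
Proof. by move=> vD; apply: vfield_mul vD; apply: is_section_ares. Qed.

Lemma mt_scale_add (a : O V) D D' l : is_vfield V D -> is_vfield V D' ->
  mt V (vadd (vscale a D) D') l l = a *: mt V D l l + mt V D' l l.
Proof. by move=> vD vD'; have [_ -> _ _ _] := tri sVT vD vD'. Qed.

Lemma mt_eq D D' l : is_vfield V D -> eq_vfield V D D' ->
  mt V D l l = mt V D' l l.
Proof.
move=> vD eD; have [H _ _ _ _] := tri sVT vD (eq_vfieldP eD vD).
exact: H.
Qed.

Lemma vfield_zero : is_vfield V (fun W _ => 0 : O W).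
Proof.
move=> W [oW _ _]; split=> [c f g|f g|W' sW' f].
- by rewrite scaler0 addr0.
- by rewrite !mulr0 addr0.
- by rewrite ares0.
Qed.

Lemma mt_zero l : mt V (fun W _ => 0 : O W) l l = 0.
Proof.
(* The zero field is also 1 * 0 + 0, so its image x satisfies x = x + x. *)
apply: addr_self_eq0; have v0 := vfield_zero.
have := mt_scale_add 1 l v0 v0; rewrite scale1r => <-.
apply: mt_eq => // W [oW _ _] f.
by rewrite /vadd /vscale mulr0 addr0.
Qed.

End Trilinear.

(** * Local trivializations of a thickening *)

Section Thickenings.
Variables (K : fieldType) (X : topologicalType) (O : algSheaf K X).
Variable Y : thickening O.

Section Trivializations.
Variables (U : set X) (del : forall V : set X, trunc (O V) 2 -> tB Y V).
Arguments del : clear implicits.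
Hypothesis triv : trivialization U del.
Variable V : set X.
Hypothesis sVU : osub V U.

Lemma triv_inj : injective (del V).
Proof. by case: (triv sVU) => /bij_inj. Qed.

Lemma triv_surj b : exists p, del V p = b.
Proof. by case: (triv sVU) => -[g _ gK] _ _ _ _; exists (g b). Qed.

Lemma trivD : {morph del V : p p' / p + p'}.
Proof. by case: (triv sVU) => _ [/zmod_fD]. Qed.

Lemma trivM : {morph del V : p p' / p * p'}.
Proof. by case: (triv sVU) => _ [_ []]. Qed.

Lemma trivZ (c : K) p : del V (c%:A *: p) = c *: del V p.
Proof. by case: (triv sVU). Qed.

Lemma triv_tpr p : tpr Y (del V p) = tcoef p 0.
Proof. by case: (triv sVU). Qed.

Lemma triv_res W : osub W V ->
  forall p, ares (tB Y) V W (del V p) = del W (tres W p).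
Proof. by case: (triv sVU) => _ _ _ _; apply. Qed.

End Trivializations.

Variables (LL : modSheaf (tB Y)) (q : forall V : set X, LL V -> tL Y V).
Arguments q : clear implicits.
Hypothesis extq : is_extension q.

(** * Transition data of an atlas and its obstruction cocycle *)

Section Atlas.
Variables (J : Type) (U : J -> set X).
Variable del : J -> forall V : set X, trunc (O V) 2 -> tB Y V.
Arguments del : clear implicits.
Variables (e : forall i, tL Y (U i)) (s : forall i, LL (U i)).

(* The part of described_by that does not involve the cocycle, which is
   recovered from the trivializations and the frames. *)
Definition framed_atlas : Prop :=
  [/\ open_cover U, forall i, trivialization (U i) (del i),
      forall i, frame (s i)
    & forall i V, osub V (U i) ->
        tiota Y (mres (tL Y) (U i) V (e i)) = del i V (tX 2) /\
        q V (mres LL (U i) V (s i)) = mres (tL Y) (U i) V (e i)].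

(** This is del_i^-1 del_j. Like [frame_change], it is chosen from the atlas itself, so that it also
    makes sense between members of two different descriptions. The default 0 is never met on
    nonempty open subsets of an overlap. *)
Definition transition i j V (p : trunc (O V) 2) : trunc (O V) 2 :=
  xget 0 [set p' | del i V p' = del j V p].
Arguments transition : clear implicits.

Definition frame_change i j V : trunc (O V) 2 :=
  xget 0 [set v | mres LL (U j) V (s j) = del i V v *: mres LL (U i) V (s i)].

Arguments frame_change : clear implicits.

(** [trD], [tra] and [trb] play the roles of D_ij, alpha_ij and beta_ij. The unit is read off from
    the frames of LL; [transition_tX] shows that it is also the factor by which t changes. *)
Definition trD i j : vfield O := fun V f => tcoef (transition i j V (tC 2 f)) 1.
Definition tra i j V : O V := tcoef (frame_change i j V) 0.
Definition trb i j V : O V := tcoef (frame_change i j V) 1.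
Arguments trD : clear implicits.
Arguments tra : clear implicits.
Arguments trb : clear implicits.

Hypothesis atlasP : framed_atlas.

Let cov : open_cover U. Proof. by case: atlasP. Qed.
Let oU i : open (U i). Proof. exact: cov.1. Qed.
Let triv i : trivialization (U i) (del i). Proof. by case: atlasP. Qed.
Let frame_s i : frame (s i). Proof. by case: atlasP. Qed.
Arguments triv : clear implicits.
Arguments frame_s : clear implicits.

Section Overlap.
Variables (i j : J) (V : set X).
Hypothesis sV : osub V (U i `&` U j).

Let sVi : osub V (U i). Proof. by apply: osub_subset sV _; apply: subIsetl. Qed.
Let sVj : osub V (U j). Proof. by apply: osub_subset sV _; apply: subIsetr. Qed.
Let oV : open V. Proof. by case: sV. Qed.
Let sVT : osub V setT. Proof. by case: sV. Qed.

Lemma transitionP p : del i V (transition i j V p) = del j V p.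
Proof.
have [p' e'] := triv_surj (triv i) sVi (del j V p).
exact: (xgetI (P := [set p' | del i V p' = del j V p]) 0 e').
Qed.

Lemma transition_uniq p p' : del i V p' = del j V p -> transition i j V p = p'.
Proof. by move=> ep; apply: (triv_inj (triv i) sVi); rewrite transitionP. Qed.

Lemma frame_changeP :
  mres LL (U j) V (s j) = del i V (frame_change i j V) *: mres LL (U i) V (s i).
Proof.
have [g _ gK] := frame_s i V sVi.
have [v ev] := triv_surj (triv i) sVi (g (mres LL (U j) V (s j))).
apply: (xgetI (P := [set v | mres LL (U j) V (s j) =
  del i V v *: mres LL (U i) V (s i)]) 0 (x := v)).
by rewrite /= ev gK.
Qed.

Lemma frame_change_uniq v :
  mres LL (U j) V (s j) = del i V v *: mres LL (U i) V (s i) ->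
  frame_change i j V = v.
Proof.
rewrite frame_changeP => es; apply: (triv_inj (triv i) sVi).
by have [g gK _] := frame_s i V sVi; rewrite -[LHS]gK es gK.
Qed.

Lemma transitionD : {morph transition i j V : p p' / p + p'}.
Proof.
move=> p p'; apply: transition_uniq.
by rewrite (trivD (triv i)) // !transitionP (trivD (triv j)).
Qed.

Lemma transitionM : {morph transition i j V : p p' / p * p'}.
Proof.
move=> p p'; apply: transition_uniq.
by rewrite (trivM (triv i)) // !transitionP (trivM (triv j)).
Qed.

Lemma transitionZ (c : K) p :
  transition i j V (c%:A *: p) = c%:A *: transition i j V p.
Proof.
apply: transition_uniq.
by rewrite (trivZ (triv i)) // !transitionP (trivZ (triv j)).
Qed.

Lemma transition_coef0 p : tcoef (transition i j V p) 0 = tcoef p 0.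
Proof. by rewrite -(triv_tpr (triv i) sVi) transitionP (triv_tpr (triv j)). Qed.

(** Since [q] is linear over [tpr] and sends s_i to e_i, it turns s_j = del_i(v) s_i into e_j = v_0
    e_i, where v_0 is the constant term of v. *)
Lemma tra_frame : mres (tL Y) (U j) V (e j) = tra i j V *: mres (tL Y) (U i) V (e i).
Proof.
have [_ _ _ He] := atlasP; have [qD _ _ _] := extq sVT.
have q0 : q V 0 = 0.
  apply: (@addrI _ (q V 0)); rewrite addr0.
  have := qD 1 0 0; rewrite scaler0 addr0.
  by have [_ [-> _]] := tpr_morph Y sVT; rewrite scale1r => <-.
rewrite -(He j V sVj).2 frame_changeP -[_ *: _]addr0 qD q0 addr0.
by rewrite (triv_tpr (triv i)) // (He i V sVi).2.
Qed.

(** Through [tiota], del_j(t) is e_j = a e_i, which is also del_i(a t). *)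
Lemma transition_tX : transition i j V (tX 2) = tC 2 (tra i j V) * tX 2.
Proof.
have [_ _ _ He] := atlasP.
apply: transition_uniq; rewrite (trivM (triv i)) // -(He i V sVi).1.
rewrite -tiota_scale // (triv_tpr (triv i)) // tcoef_tC -tra_frame.
exact: (He j V sVj).1.
Qed.

(** Thus del_i^-1 del_j has the form Phi_{D,a}: by multiplicativity it is determined by its values
    on constants and on t. *)
Lemma transitionE p : transition i j V p =
  tC 2 (tcoef p 0) + tC 2 (trD i j V (tcoef p 0) + tra i j V * tcoef p 1) * tX 2.
Proof.
rewrite {1}[p]trunc2E transitionD transitionM transition_tX.
apply: trunc2P; rewrite !tcoefE !transition_coef0 !tcoefE /=; first by ring.
by rewrite -/(trD i j V _); ring.
Qed.

End Overlap.

Lemma trans_sub i j k V : osub V (U i `&` U j `&` U k) ->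
  [/\ osub V (U i `&` U j), osub V (U j `&` U k) & osub V (U i `&` U k)].
Proof.
by move=> sV; split; apply: (osub_subset sV) => x [[]].
Qed.

Lemma transition_trans i j k V p : osub V (U i `&` U j `&` U k) ->
  transition i j V (transition j k V p) = transition i k V p.
Proof.
move=> sV; have [sij sjk sik] := trans_sub sV.
by apply/esym/transition_uniq => //; rewrite !transitionP.
Qed.

Lemma transition_res i j V W p : osub V (U i `&` U j) -> osub W V ->
  tres W (transition i j V p) = transition i j W (tres W p).
Proof.
move=> sV sW; apply/esym/transition_uniq; first exact: osub_trans sV sW.
have sVi : osub V (U i) by apply: osub_subset sV _; apply: subIsetl.
have sVj : osub V (U j) by apply: osub_subset sV _; apply: subIsetr.
by rewrite -(triv_res (triv i) sVi) // transitionP // (triv_res (triv j)).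
Qed.

Lemma frame_change_res i j V W : osub V (U i `&` U j) -> osub W V ->
  tres W (frame_change i j V) = frame_change i j W.
Proof.
move=> sV sW; apply/esym/frame_change_uniq; first exact: osub_trans sV sW.
have sVi : osub V (U i) by apply: osub_subset sV _; apply: subIsetl.
have sVj : osub V (U j) by apply: osub_subset sV _; apply: subIsetr.
have oV : open V by case: sV.
rewrite -(mres_comp (oU j) sVj sW) (frame_changeP sV) mresZ //.
by rewrite (triv_res (triv i)) // mres_comp.
Qed.

(** Express s_k through s_j, then s_j through s_i; [transition] rewrites the coefficient del_j(u_jk)
    as a value of del_i. *)
Lemma frame_change_trans i j k V : osub V (U i `&` U j `&` U k) ->
  frame_change i j V * transition i j V (frame_change j k V) = frame_change i k V.
Proof.
move=> sV; have [sij sjk sik] := trans_sub sV.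
have sVi : osub V (U i) by apply: osub_subset sij _; apply: subIsetl.
apply/esym/frame_change_uniq => //.
rewrite (frame_changeP sjk) (frame_changeP sij) scalerA.
by rewrite (trivM (triv i)) // transitionP // mulrC.
Qed.

Lemma trD_vfield i j : is_vfield (U i `&` U j) (trD i j).
Proof.
move=> V sV; have oV : open V by case: sV.
split=> [c f g|f g|W sW f]; rewrite /trD.
- have -> : tC 2 (c *: f + g) = c%:A *: tC 2 f + tC 2 g.
    by rewrite tCD -tCZ mulr_algl.
  by rewrite transitionD // transitionZ // !tcoefE mulr_algl.
- by rewrite tCM transitionM // !tcoefE !transition_coef0 // !tcoefE /=; ring.
- by rewrite -tcoef_tres // (transition_res _ sV) // tres_tC.
Qed.

Lemma tra_section i j : is_section (U i `&` U j) (tra i j).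
Proof.
move=> V W sV sW; have oV : open V by case: sV.
by rewrite /tra -tcoef_tres // (frame_change_res sV).
Qed.

Lemma trb_section i j : is_section (U i `&` U j) (trb i j).
Proof.
move=> V W sV sW; have oV : open V by case: sV.
by rewrite /trb -tcoef_tres // (frame_change_res sV).
Qed.

Section TripleOverlap.
Variables (i j k : J) (V : set X).
Hypothesis sV : osub V (U i `&` U j `&` U k).

Lemma trD_trans f : trD i k V f = trD i j V f + tra i j V * trD j k V f.
Proof.
have [sij sjk sik] := trans_sub sV.
rewrite /(trD i k V f) -(transition_trans _ sV) transitionE //.
by rewrite !tcoefE !transition_coef0 // !tcoefE /= -/(trD j k V f); ring.
Qed.

Lemma tra_trans : tra i k V = tra i j V * tra j k V.
Proof.
have [sij sjk sik] := trans_sub sV.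
by rewrite /(tra i k V) -(frame_change_trans sV) !tcoefE transition_coef0.
Qed.

(** Compare the coefficients of t in u_ij * phi_ij(u_jk) = u_ik. *)
Lemma trb_trans : trb i k V =
  trb i j V * tra j k V + tra i j V * trD i j V (tra j k V)
  + tra i j V ^+ 2 * trb j k V.
Proof.
have [sij sjk sik] := trans_sub sV.
rewrite /(trb i k V) -(frame_change_trans sV) !tcoefE transition_coef0 //.
by rewrite transitionE // !tcoefE /= /tra /trb; ring.
Qed.

End TripleOverlap.

Variable E : J -> J -> vfield O.
Arguments E : clear implicits.

(** Let g_ij be given by f |-> f + D_ij(f) t + E_ij(f) t^2, t |-> a_ij t + b_ij t^2. An element of
    the kernel of tau_2 affects only the t^2 coefficient, so the defect of g_ij g_jk = g_ik is the
    difference of the t^2 coefficients of both sides on functions f. *)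
Definition jet_obstruction i j k : vfield O := fun V f =>
  E i j V f + tra i j V * trD i j V (trD j k V f) + trb i j V * trD j k V f
  + tra i j V ^+ 2 * E j k V f - E i k V f.
Arguments jet_obstruction : clear implicits.

Hypothesis jetE : forall i j, is_jet (U i `&` U j) (trD i j) (E i j).

(** By [jet_comp] the first four terms form a jet over D_ij + a_ij D_jk = D_ik, and [E i k] is
    another one. *)
Lemma jet_obstruction_vfield i j k :
  is_vfield (U i `&` U j `&` U k) (jet_obstruction i j k).
Proof.
have sij : U i `&` U j `&` U k `<=` U i `&` U j by move=> x [].
have sjk : U i `&` U j `&` U k `<=` U j `&` U k by move=> x [[]].
have sik : U i `&` U j `&` U k `<=` U i `&` U k by move=> x [[]].
apply: (jet_sub (jet_comp (is_sectionS sij (@tra_section i j))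
  (is_sectionS sij (@trb_section i j)) (is_jetS sij (jetE i j))
  (is_jetS sjk (jetE j k))) (is_jetS sik (jetE i k))).
by move=> V sV f; rewrite (trD_trans sV).
Qed.

(** The [E] terms cancel in pairs because a_ik = a_ij a_jk. The remaining terms cancel by the
    transition rules for D and b and the Leibniz rule for D_ij on a_jk D_kl(f). *)
Lemma jet_obstruction_cocycle i j k l V :
  osub V (U i `&` U j `&` U k `&` U l) -> forall f,
  tra i j V ^+ 2 * jet_obstruction j k l V f - jet_obstruction i k l V f
  + jet_obstruction i j l V f - jet_obstruction i j k V f = 0.
Proof.
move=> sV f; rewrite /jet_obstruction.
have sijk : osub V (U i `&` U j `&` U k) by apply: osub_subset sV _ => x [].
have sjkl : osub V (U j `&` U k `&` U l).
  by apply: osub_subset sV _ => x [[[]]].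
have [sij sjk sik] := trans_sub sijk.
rewrite (trD_trans sijk) (tra_trans sijk) (trb_trans sijk).
rewrite (trD_trans sjkl) (vfieldD (@trD_vfield i j)) //.
by rewrite (vfieldM (@trD_vfield i j)) //; ring.
Qed.

Variables (F : modSheaf O) (mt : forall V : set X, vfield O -> tL Y V -> tL Y V -> F V).
Arguments mt : clear implicits.
Hypothesis tri : trilinear mt.

Lemma twist2_res (rho : J -> J -> J -> vfield O) i j k V :
  is_vfield (U i `&` U j `&` U k) (rho i j k) ->
  osub V (U i `&` U j `&` U k) ->
  mres F _ V (twist2 mt e rho i j k) =
  mt V (rho i j k) (mres (tL Y) _ V (e i)) (mres (tL Y) _ V (e i)).
Proof.
move=> vrho sV.
have sT : osub (U i `&` U j `&` U k) setT.
  case: sV => _ [x Vx] sV; split=> //; last by exists x; apply: sV.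
  by apply: openI => //; apply: openI.
have [_ _ _ _ ->//] := tri sT vrho vrho.
rewrite mres_comp //; case: sT => oT T0 _; split=> // x [[]] //.
Qed.

Lemma jet_obstruction_is_cocycle2 : is_cocycle2 (twist2 mt e jet_obstruction).
Proof.
move=> i j k l V sV.
have sijk : osub V (U i `&` U j `&` U k) by apply: osub_subset sV _ => x [].
have sijl : osub V (U i `&` U j `&` U l) by apply: osub_subset sV _ => x [[[]]].
have sikl : osub V (U i `&` U k `&` U l) by apply: osub_subset sV _ => x [[[]]].
have sjkl : osub V (U j `&` U k `&` U l) by apply: osub_subset sV _ => x [[[]]].
have [sij _ _] := trans_sub sijk.
have sVT : osub V setT by case: sV.
have vV i' j' k' : osub V (U i' `&` U j' `&` U k') ->
    is_vfield V (jet_obstruction i' j' k').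
  by move=> [_ _ sub]; apply: (is_vfieldS sub); apply: jet_obstruction_vfield.
rewrite !twist2_res //; try exact: jet_obstruction_vfield.
(* The (j,k,l) term is framed by e_j = a e_i; [mtZZ] turns this into the factor a^2 of the twisted
   cocycle relation. *)
rewrite (tra_frame sij); set l0 := mres _ _ _ (e i); set a := tra i j V.
have vJ := vV j k l sjkl; have vI := vV i k l sikl.
have vL := vV i j l sijl; have vK := vV i j k sijk.
have v0 := @vfield_zero _ _ O V.
rewrite (mtZZ tri) //.
have vS := fun a => @vfield_scale _ _ O _ sVT a.
(* The alternating sum is rebuilt as the image of a single field, nested in the shape that
   [mt_scale_add] unfolds and ending in 0; this field vanishes by [jet_obstruction_cocycle]. *)
have v4 := vfield_add (vS (-1) _ vK) v0.
have v3 := vfield_add (vS 1 _ vL) v4.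
have v2 := vfield_add (vS (-1) _ vI) v3.
have v1 := vfield_add (vS (a ^+ 2) _ vJ) v2.
rewrite -[RHS](mt_zero tri sVT l0) -[RHS](mt_eq tri sVT l0 v1).
  rewrite !(mt_scale_add tri) // (mt_zero tri) //.
  by rewrite scale1r !scaleN1r addr0 !addrA.
move=> W sW f; rewrite /vadd /vscale.
have sWV := osub_trans sV sW; have oV : open V by case: sV.
rewrite aresM // aresN // ares1 // mul1r !mulN1r (tra_section sij) // addr0.
by rewrite -expr2 -(jet_obstruction_cocycle sWV f) !addrA.
Qed.

End Atlas.
End Thickenings.
Arguments transition {K X O Y J} del i j V p.
Arguments frame_change {K X O Y LL J U} del s i j V.
Arguments trD {K X O Y J} del i j V f : rename.
Arguments tra {K X O Y LL J U} del s i j V.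
Arguments trb {K X O Y LL J U} del s i j V.
Arguments jet_obstruction {K X O Y LL J U} del s E i j k V f : rename.

(** * Independence of the obstruction class from all choices *)

Section Comparison.
Variables (K : fieldType) (X : topologicalType) (O : algSheaf K X).
Variable Y : thickening O.
Variables (LL : modSheaf (tB Y)) (q : forall V : set X, LL V -> tL Y V).
Hypothesis extq : is_extension q.
Variables (F : modSheaf O) (mt : forall V : set X, vfield O -> tL Y V -> tL Y V -> F V).
Hypothesis tri : trilinear mt.

Lemma described_atlas (I : Type) (U : I -> set X) (phi : I -> I -> taut O 2)
  (u : forall i j, trunc (O (U i `&` U j)) 2)
  (del : I -> forall V : set X, trunc (O V) 2 -> tB Y V)
  (e : forall i, tL Y (U i)) (s : forall i, LL (U i)) :
  open_cover U -> described_by q phi u del e s -> framed_atlas q del e s.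
Proof. by move=> cU [tr fr es _]. Qed.

Section Described.
Variables (I : Type) (U : I -> set X) (phi : I -> I -> taut O 2).
Variable u : forall i j, trunc (O (U i `&` U j)) 2.
Variable del : I -> forall V : set X, trunc (O V) 2 -> tB Y V.
Variables (e : forall i, tL Y (U i)) (s : forall i, LL (U i)).
Hypotheses (cU : open_cover U) (desc : described_by q phi u del e s).
Arguments phi : clear implicits.

Let atl := described_atlas cU desc.

Lemma described_transition i j V p : osub V (U i `&` U j) ->
  transition del i j V p = phi i j V p.
Proof.
move=> sV; case: desc => _ _ _ H.
by apply: (transition_uniq atl) => //; case: (H i j V sV) => ->.
Qed.

Lemma described_frame_change i j V : osub V (U i `&` U j) ->
  frame_change del s i j V = tres V (u i j).
Proof.
move=> sV; case: desc => _ _ _ H.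
by apply: (frame_change_uniq atl) => //; case: (H i j V sV).
Qed.

(** * Arbitrary lifts to G_3 and their jets *)

Section Lifts.
Variable g : I -> I -> taut O 3.
Arguments g : clear implicits.
Hypothesis liftg : forall i j,
  in_G (U i `&` U j) (g i j) /\ tau2_eq (g i j) (phi i j) (u i j).

Definition liftE i j : vfield O := fun V f => tcoef (g i j V (tC 3 f)) 2.
Arguments liftE : clear implicits.

Section Overlap.
Variables (i j : I) (V : set X).
Hypothesis sV : osub V (U i `&` U j).

Lemma liftD : {morph g i j V : p p' / p + p'}.
Proof. by have [_ [/zmod_fD]] := (liftg i j).1 V sV. Qed.

Lemma liftM : {morph g i j V : p p' / p * p'}.
Proof. by have [_ [_ []]] := (liftg i j).1 V sV. Qed.

Lemma lift_coef0 p : tcoef (g i j V p) 0 = tcoef p 0.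
Proof. by have [] := (liftg i j).1 V sV. Qed.

Lemma lift_coef1 f : tcoef (g i j V (tC 3 f)) 1 = trD del i j V f.
Proof.
have [cutg _] := (liftg i j).2 V sV.
have -> : tcoef (g i j V (tC 3 f)) 1 = tcoef (tcut 2 (g i j V (tC 3 f))) 1.
  by rewrite tcoef_tcut.
rewrite cutg -described_transition // /trD; congr (tcoef (transition _ _ _ _ _) 1).
by apply: trunc2P; rewrite !tcoefE.
Qed.

Lemma lift_tC f : g i j V (tC 3 f) =
  tC 3 f + tC 3 (trD del i j V f) * tX 3 + tC 3 (liftE i j V f) * (tX 3 * tX 3).
Proof.
by rewrite [LHS]trunc3E lift_coef0 lift_coef1 tcoef_tC.
Qed.

Lemma lift_tX : g i j V (tX 3) =
  tC 3 (tra del s i j V) * tX 3 + tC 3 (trb del s i j V) * (tX 3 * tX 3).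
Proof.
(* As t^3 = 0, the product w t depends only on w modulo t^2, which is u. *)
have [_ [w [-> cutw]]] := (liftg i j).2 V sV.
rewrite /tra /trb described_frame_change // -cutw.
by apply: trunc3P; rewrite !tcoefE /=; ring.
Qed.

Lemma lift_coef2 p : tcoef (g i j V p) 2 =
  liftE i j V (tcoef p 0) + tra del s i j V * trD del i j V (tcoef p 1)
  + trb del s i j V * tcoef p 1 + tra del s i j V ^+ 2 * tcoef p 2.
Proof.
rewrite [in LHS](trunc3E p) !liftD !liftM lift_tX !lift_tC.
by rewrite !tcoefE /=; ring.
Qed.

End Overlap.

(** The product rule is the t^2 coefficient of g_ij(f f') = g_ij(f) g_ij(f'). *)
Lemma liftE_jet i j : is_jet (U i `&` U j) (trD del i j) (liftE i j).
Proof.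
split; first exact: (trD_vfield atl).
move=> V sV; have oV : open V by case: sV.
have [_ _ gZ _ gres] := (liftg i j).1 V sV.
split=> [c f g'|f g'|W sW f]; rewrite /liftE.
- have -> : tC 3 (c *: f + g') = c%:A *: tC 3 f + tC 3 g'.
    by rewrite tCD -tCZ mulr_algl.
  by rewrite liftD // gZ !tcoefE mulr_algl.
- by rewrite tCM liftM // !tcoefE !lift_coef0 // !lift_coef1 // !tcoefE /=; ring.
- by rewrite -tcoef_tres // gres // tres_tC.
Qed.

Variable rho : I -> I -> I -> vfield O.
Hypothesis gV : forall i j V, osub V (U i `&` U j) ->
  forall p, g i j V (g j i V p) = p.
Hypothesis kerg : forall i j k, kernel_elt (U i `&` U j `&` U k)
  (fun V p => g i j V (g j k V (g k i V p))) (rho i j k).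

(** From g_ki g_ik = 1, g_ij g_jk = (g_ij g_jk g_ki) g_ik; the t^2 coefficients on f then give rho.
    So every obstruction cocycle depends on its lifts only through their jets. *)
Lemma lift_obstruction i j k :
  eq_vfield (U i `&` U j `&` U k) (jet_obstruction del s liftE i j k) (rho i j k).
Proof.
move=> V sV f; have [sij sjk sik] := trans_sub sV.
have ski : osub V (U k `&` U i) by rewrite setIC.
have [_ /(_ V sV) [kC kX]] := kerg i j k.
have : g i j V (g j k V (tC 3 f)) =
    g i j V (g j k V (g k i V (g i k V (tC 3 f)))) by rewrite gV.
rewrite [in RHS]lift_tC //.
rewrite !(liftD ski, liftM ski, liftD sjk, liftM sjk, liftD sij, liftM sij).
rewrite !kC !kX => /(congr1 (fun p => tcoef p 2)).
rewrite lift_coef2 // lift_coef0 // lift_coef1 // -/(liftE j k V f) expr2 !tcoefE /=.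
rewrite /jet_obstruction => ->.
ring.
Qed.

End Lifts.
End Described.

(** * Comparison of two atlases *)

Section Atlases.
Hypothesis char2 : 2%:R != 0 :> K.

(** After reindexing by [r] the two cocycles coincide, so the zero 1-cochain is the witness. *)
Lemma pullback_refines (J J' : Type) (r : J' -> J) (U : J -> set X)
  (del : J -> forall V : set X, trunc (O V) 2 -> tB Y V)
  (e : forall i, tL Y (U i)) (s : forall i, LL (U i))
  (rho : J -> J -> J -> vfield O) (rho' : J' -> J' -> J' -> vfield O)
  (cov : open_cover U) (cov' : open_cover (U \o r))
  (cP : is_cocycle2 (twist2 mt e rho))
  (cP' : is_cocycle2 (twist2 mt (fun i => e (r i)) rho')) :
  framed_atlas q del e s ->
  framed_atlas q (fun i => del (r i)) (fun i => e (r i)) (fun i => s (r i)) ->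
  (forall i j k, is_vfield (U i `&` U j `&` U k) (rho i j k)) ->
  (forall i j k, eq_vfield (U (r i) `&` U (r j) `&` U (r k))
                   (rho (r i) (r j) (r k)) (rho' i j k)) ->
  refined_cohomologous (Cocycle2 cov cP) (Cocycle2 cov' cP').
Proof.
move=> atl atl' vrho erho; exists r, (fun i j => 0); split=> [i x //|i j k V sV].
have vrho' : is_vfield (U (r i) `&` U (r j) `&` U (r k)) (rho' i j k).
  exact: eq_vfieldP (erho i j k) (vrho _ _ _).
have [sij sjk sik] := @trans_sub _ _ (U \o r) i j k V sV.
have oUr i' j' : open (U (r i') `&` U (r j')).
  by apply: openI; apply: cov.1.
rewrite /= !mres0 // subrr !addr0.
rewrite (twist2_res atl' tri vrho' sV) (twist2_res atl tri (vrho _ _ _) sV).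
have sVT : osub V setT by case: sV.
apply/esym/(mt_eq tri sVT) => [|W sW f].
  by case: sV => _ _ sub; apply: is_vfieldS sub (vrho _ _ _).
by apply: erho; apply: osub_trans sV sW.
Qed.

Lemma jet_cocycles_equiv (I1 I2 : Type) (U1 : I1 -> set X) (U2 : I2 -> set X)
  (del1 : I1 -> forall V : set X, trunc (O V) 2 -> tB Y V)
  (del2 : I2 -> forall V : set X, trunc (O V) 2 -> tB Y V)
  (e1 : forall i, tL Y (U1 i)) (e2 : forall i, tL Y (U2 i))
  (s1 : forall i, LL (U1 i)) (s2 : forall i, LL (U2 i))
  (E1 : I1 -> I1 -> vfield O) (E2 : I2 -> I2 -> vfield O)
  (rho1 : I1 -> I1 -> I1 -> vfield O) (rho2 : I2 -> I2 -> I2 -> vfield O)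
  (cov1 : open_cover U1) (cov2 : open_cover U2)
  (cP1 : is_cocycle2 (twist2 mt e1 rho1)) (cP2 : is_cocycle2 (twist2 mt e2 rho2)) :
  framed_atlas q del1 e1 s1 -> framed_atlas q del2 e2 s2 ->
  (forall i j, is_jet (U1 i `&` U1 j) (trD del1 i j) (E1 i j)) ->
  (forall i j, is_jet (U2 i `&` U2 j) (trD del2 i j) (E2 i j)) ->
  (forall i j k, eq_vfield (U1 i `&` U1 j `&` U1 k)
    (jet_obstruction del1 s1 E1 i j k) (rho1 i j k)) ->
  (forall i j k, eq_vfield (U2 i `&` U2 j `&` U2 k)
    (jet_obstruction del2 s2 E2 i j k) (rho2 i j k)) ->
  H2class (Cocycle2 cov1 cP1) (Cocycle2 cov2 cP2).
Proof.
move=> atl1 atl2 jet1 jet2 erho1 erho2.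
pose U (x : I1 + I2) := match x with inl i => U1 i | inr i => U2 i end.
pose del (x : I1 + I2) : forall V : set X, trunc (O V) 2 -> tB Y V :=
  match x with inl i => del1 i | inr i => del2 i end.
pose e (x : I1 + I2) : tL Y (U x) :=
  match x with inl i => e1 i | inr i => e2 i end.
pose s (x : I1 + I2) : LL (U x) :=
  match x with inl i => s1 i | inr i => s2 i end.
(* On mixed overlaps any jet over the transition derivation will do; half its square is one. *)
pose E (x y : I1 + I2) : vfield O := match x, y with
  | inl i, inl j => E1 i j
  | inr i, inr j => E2 i j
  | _, _ => fun V f => 2%:R^-1 *: trD del x y V (trD del x y V f)
  end.
have cov : open_cover U.
  split=> [[i|i]|x]; [exact: cov1.1|exact: cov2.1|].
  by have [i Ui] := cov1.2 x; exists (inl i).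
have atl : framed_atlas q del e s.
  case: atl1 => _ tr1 fr1 es1; case: atl2 => _ tr2 fr2 es2.
  by split=> //; [case|case|case].
have jetE x y : is_jet (U x `&` U y) (trD del x y) (E x y).
  case: x y => [i|i] [j|j]; [exact: jet1| | |exact: jet2];
    by apply: jet_half_square => //; apply: (trD_vfield atl).
have cP := jet_obstruction_is_cocycle2 extq atl jetE tri.
have vJ := jet_obstruction_vfield extq atl jetE.
(* The cocycle of the union atlas pulls back to the first one along [inl] and to the second along
   [inr]. *)
apply: (@rst_trans _ _ _ (Cocycle2 cov cP)); first apply: rst_sym; apply: rst_step.
- exact: (@pullback_refines _ _ inl U del e s _ _ cov cov1 cP cP1 atl atl1 vJ erho1).
- exact: (@pullback_refines _ _ inr U del e s _ _ cov cov2 cP cP2 atl atl2 vJ erho2).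
Qed.

(** By [lift_obstruction] both cocycles are jet obstructions, for the jets of their lifts, so
    [jet_cocycles_equiv] applies. *)
Lemma obstruction_cocycle_unique (c c' : cocycle2 F) :
  obstruction_cocycle q mt c -> obstruction_cocycle q mt c' -> H2class c c'.
Proof.
move=> [I [U [phi [u [del [e [s [g [rho [cov [cP [[_ desc] lift gV ker ->]]]]]]]]]]]].
move=> [I' [U' [phi' [u' [del' [e' [s' [g' [rho' [cov' [cP'
  [[_ desc'] lift' gV' ker' ->]]]]]]]]]]]].
apply: (jet_cocycles_equiv cov cov' cP cP' (described_atlas cov desc) (described_atlas cov' desc')
  (liftE_jet cov desc lift) (liftE_jet cov' desc' lift')).
- exact: (lift_obstruction cov desc lift gV ker).
- exact: (lift_obstruction cov' desc' lift' gV' ker').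
Qed.

End Atlases.
End Comparison.

(** * Explicit lifts with g_ji = g_ij^-1, and the formula for rho *)

Section SymmetricLift.
Variables (K : fieldType) (X : topologicalType) (O : algSheaf K X).
Hypothesis char2 : 2%:R != 0 :> K.
Variable Y : thickening O.
Variables (LL : modSheaf (tB Y)) (q : forall V : set X, LL V -> tL Y V).
Hypothesis extq : is_extension q.
Variables (J : Type) (U : J -> set X).
Variable del : J -> forall V : set X, trunc (O V) 2 -> tB Y V.
Arguments del : clear implicits.
Variables (e : forall i, tL Y (U i)) (s : forall i, LL (U i)).
Hypothesis atl : framed_atlas q del e s.

Local Notation D := (trD del).
Local Notation a := (tra del s).
Local Notation b := (trb del s).

Let vD i j : is_vfield (U i `&` U j) (D i j).
Proof. exact: (trD_vfield atl). Qed.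

Lemma transition_diag i V p : osub V (U i `&` U i) -> transition del i i V p = p.
Proof. by move=> sV; apply: (transition_uniq atl). Qed.

Lemma frame_change_diag i V : osub V (U i `&` U i) -> frame_change del s i i V = 1.
Proof.
move=> sV; apply: (frame_change_uniq atl) => //.
have [_ /(_ i) tr _ _] := atl.
have sVi : osub V (U i) by apply: osub_subset sV _; apply: subIsetl.
have [p p1] := triv_surj tr sVi 1.
have -> : del i V 1 = 1 by rewrite -[RHS]p1 -[p]mul1r (trivM tr) // p1 mulr1.
by rewrite scale1r.
Qed.

Lemma trD_diag i V f : osub V (U i `&` U i) -> D i i V f = 0.
Proof. by move=> sV; rewrite /trD transition_diag // !tcoefE. Qed.

Lemma tra_diag i V : osub V (U i `&` U i) -> a i i V = 1.
Proof. by move=> sV; rewrite /tra frame_change_diag // !tcoefE. Qed.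

Lemma trb_diag i V : osub V (U i `&` U i) -> b i i V = 0.
Proof. by move=> sV; rewrite /trb frame_change_diag // !tcoefE. Qed.

(** The transition rule gives a_ij a_ji = a_ii = 1. *)
Lemma tra_unit i j V : osub V (U i `&` U j) -> a i j V \is a GRing.unit.
Proof.
move=> sV; apply/unitrPr; exists (a j i V).
have sV' : osub V (U i `&` U j `&` U i) by apply: osub_subset sV _ => x [].
by rewrite -(tra_trans atl sV') tra_diag //; case: (trans_sub sV').
Qed.

Definition trc i j V := (b i j V - D i j V (a i j V)) / a i j V.

Lemma trbE i j V : osub V (U i `&` U j) ->
  b i j V = a i j V * trc i j V + D i j V (a i j V).
Proof. by move=> sV; rewrite /trc mulrC divrK ?tra_unit // subrK. Qed.

Lemma trc_section i j : is_section (U i `&` U j) (trc i j).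
Proof.
move=> V W sV sW; have oV : open V by case: sV.
rewrite /trc aresM // aresV ?tra_unit // aresB //.
rewrite (tra_section atl sV sW) (trb_section atl sV sW).
by rewrite (vfield_res (@vD i j)) // (tra_section atl sV sW).
Qed.

(** In terms of c = (b - D(a)) / a the quadratic rule [trb_trans] becomes affine in c. *)
Lemma trc_trans i j k V : osub V (U i `&` U j `&` U k) ->
  trc i k V = trc i j V + a i j V * trc j k V - D j k V (a i j V).
Proof.
move=> sV; have [sij sjk sik] := trans_sub sV.
(* Multiplying by a_ik and adding D_ik(a_ik) turns the left side into b_ik, to which [trb_trans]
   applies. *)
apply: (mulrI (tra_unit sik)); apply: (addIr (D i k V (a i k V))).
rewrite -trbE // (trb_trans extq atl sV) (trD_trans extq atl sV).
rewrite (tra_trans atl sV) (trbE sij) (trbE sjk).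
rewrite (vfieldM (@vD i j)) //.
by rewrite (vfieldM (@vD j k)) //; ring.
Qed.

Lemma trc_diag i V : osub V (U i `&` U i) -> trc i i V = 0.
Proof. by move=> sV; rewrite /trc trb_diag // trD_diag // subrr mul0r. Qed.

(* The correction by trc makes the lifts of h_ij and h_ji inverse to each
   other. *)
Definition symE i j : vfield O :=
  vadd (fun V f => 2%:R^-1 *: D i j V (D i j V f))
       (fun V f => (2%:R^-1 *: trc i j V) * D i j V f).

Lemma symE_jet i j : is_jet (U i `&` U j) (D i j) (symE i j).
Proof.
apply: jet_add_vfield; first exact: jet_half_square char2 (@vD i j).
apply: vfield_mul (@vD i j) => V W sV sW.
by rewrite aresZ ?trc_section //; case: sV.
Qed.

Lemma double_half (V : set X) (f : O V) : 2%:R^-1 *: f + 2%:R^-1 *: f = f.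
Proof. by rewrite -scalerDl -[_^-1]mul1r -mulrDl divff // scale1r. Qed.

Lemma symE_double i j V f : symE i j f + symE i j f =
  D i j V (D i j V f) + trc i j V * D i j V f.
Proof. by rewrite /symE /vadd addrACA double_half -mulrDl double_half. Qed.

Lemma symE_obstruction i j k V f : osub V (U i `&` U j `&` U k) ->
  jet_obstruction del s symE i j k V f =
  2%:R^-1 *: (b i j V * D j k V f
    + (D j k V (a i j V) - a i j V * trc j k V) * D i j V f
    + a i j V * (D i j V (D j k V f) - D j k V (D i j V f))).
Proof.
move=> sV; have [sij sjk sik] := trans_sub sV.
(* Both sides are doubled: each [symE] is then paired with its copy, and [symE_double] removes the
   halves before [ring]. *)
rewrite -[LHS]double_half -scalerDr; congr (_ *: _).
rewrite /jet_obstruction; set x := symE i j f; set y := symE j k f.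
set z := symE i k f; set A := a i j V.
have -> w w' : x + w + w' + A ^+ 2 * y - z + (x + w + w' + A ^+ 2 * y - z) =
  (x + x) + (w + w) + (w' + w') + A ^+ 2 * (y + y) - (z + z) by ring.
rewrite !symE_double (trc_trans sV) !(trD_trans extq atl sV) (trbE sij) -/A.
rewrite (vfieldD (@vD i j)) //.
rewrite (vfieldD (@vD j k)) //.
rewrite (vfieldM (@vD i j)) //.
by rewrite (vfieldM (@vD j k)) //; ring.
Qed.

Lemma symE_diag i V f : osub V (U i `&` U i) -> symE i i f = 0 :> O V.
Proof.
by move=> sV; rewrite /symE /vadd !trD_diag // scaler0 mulr0 addr0.
Qed.

(** For k = i the transition rules read D_ij = - a_ij D_ji and c_ij = D_ji(a_ij) - a_ij c_ji.
    Substituting them, all terms of [symE_obstruction] cancel. *)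
Lemma symE_obstruction_inv i j V f : osub V (U i `&` U j) ->
  jet_obstruction del s symE i j i V f = 0.
Proof.
move=> sij; have sV : osub V (U i `&` U j `&` U i).
  by apply: osub_subset sij _ => x [].
have [_ sji sii] := trans_sub sV.
rewrite symE_obstruction //; have := trc_trans sV.
rewrite trc_diag // => /esym/eqP; rewrite subr_eq0 => /eqP ec.
have eD g : D i j V g = - (a i j V * D j i V g).
  by apply/eqP; rewrite -addr_eq0 -(trD_trans extq atl sV) trD_diag.
rewrite trbE // !eD -ec.
rewrite (vfieldN (@vD j i)) //.
rewrite (vfieldM (@vD j i)) //.
by rewrite -ec -[RHS](scaler0 _ (2%:R^-1)); congr (_ *: _); ring.
Qed.

(** The image of p_0 + p_1 t + p_2 t^2 under f |-> f + D(f) t + E(f) t^2, t |-> a t + b t^2 with E =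
    [symE]; compare [lift_coef2]. *)
Definition sym_lift i j : taut O 3 := fun V p =>
  tC 3 (tcoef p 0)
  + tC 3 (D i j V (tcoef p 0) + a i j V * tcoef p 1) * tX 3
  + tC 3 (symE i j (tcoef p 0) + a i j V * D i j V (tcoef p 1)
          + b i j V * tcoef p 1 + a i j V ^+ 2 * tcoef p 2) * (tX 3 * tX 3).
Arguments sym_lift : clear implicits.

Lemma sym_lift_coef0 i j V p : tcoef (sym_lift i j V p) 0 = tcoef p 0.
Proof. by rewrite !tcoefE /=; ring. Qed.

Lemma sym_lift_coef1 i j V p : tcoef (sym_lift i j V p) 1 =
  D i j V (tcoef p 0) + a i j V * tcoef p 1.
Proof. by rewrite !tcoefE /=; ring. Qed.

Lemma sym_lift_coef2 i j V p : tcoef (sym_lift i j V p) 2 =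
  symE i j (tcoef p 0) + a i j V * D i j V (tcoef p 1)
  + b i j V * tcoef p 1 + a i j V ^+ 2 * tcoef p 2.
Proof. by rewrite !tcoefE /=; ring. Qed.

Definition sym_lift_coefE := (sym_lift_coef0, sym_lift_coef1, sym_lift_coef2).

(** The rules for D and a give agreement modulo t^2, and the rule for b gives agreement on t; what
    remains is the defect of the jets on the constant term of p. *)
Lemma sym_lift_trans i j k V p : osub V (U i `&` U j `&` U k) ->
  sym_lift i j V (sym_lift j k V p) = sym_lift i k V p
  + tC 3 (jet_obstruction del s symE i j k V (tcoef p 0)) * (tX 3 * tX 3).
Proof.
move=> sV; have [sij sjk sik] := trans_sub sV.
apply: trunc3P; rewrite tcoefD !sym_lift_coefE !tcoefE /=; first by ring.
  by rewrite (trD_trans extq atl sV) (tra_trans atl sV); ring.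
rewrite /jet_obstruction !(trD_trans extq atl sV) (tra_trans atl sV).
rewrite (trb_trans extq atl sV).
rewrite (vfieldD (@vD i j)) //.
by rewrite (vfieldM (@vD i j)) //; ring.
Qed.

Lemma sym_lift_diag i V p : osub V (U i `&` U i) -> sym_lift i i V p = p.
Proof.
move=> sV; apply: trunc3P; rewrite !sym_lift_coefE ?trD_diag ?tra_diag //.
  by ring.
by rewrite symE_diag // trb_diag //; ring.
Qed.

Lemma sym_liftK i j V : osub V (U i `&` U j) ->
  forall p, sym_lift i j V (sym_lift j i V p) = p.
Proof.
move=> sij p; have sV : osub V (U i `&` U j `&` U i).
  by apply: osub_subset sij _ => x [].
have [_ _ sii] := trans_sub sV.
rewrite sym_lift_trans // sym_lift_diag // symE_obstruction_inv //.
by apply: trunc3P; rewrite !tcoefE /=; ring.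
Qed.

Lemma sym_lift_inG i j : in_G (U i `&` U j) (sym_lift i j).
Proof.
move=> V sV; have oV : open V by case: sV.
have sV' : osub V (U j `&` U i) by rewrite setIC.
have vDij := @vD i j.
have jE := symE_jet i j.
have D1 : D i j V 1 = 0 by exact: vfield1 vDij _ sV.
(* As D(1) = 0, the product rule at 1 * 1 reads E(1) = E(1) + E(1). *)
have E1 : symE i j (1 : O V) = 0.
  have := jetM jE sV 1 1; rewrite D1 !mul1r mul0r addr0.
  exact: addr_self_eq0.
split=> [||c p|p|W sW p].
- by exists (sym_lift j i V); [exact: sym_liftK sV'|exact: sym_liftK sV].
- split=> [p p'|].
    apply: trunc3P; rewrite tcoefB !sym_lift_coefE ?tcoefB //.
      by rewrite (vfieldD vDij) // (vfieldN vDij) //; ring.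
    rewrite !(vfieldD vDij, jetD jE) // !(vfieldN vDij) //.
    have -> : symE i j (- tcoef p' 0) = - symE i j (tcoef p' 0).
      by rewrite -scaleN1r (jetZ jE) // scaleN1r.
    by ring.
  split=> [|p p'].
    by apply: trunc3P; rewrite !sym_lift_coefE !tcoefE /= ?D1 ?E1
      ?(vfield0 vDij) //; ring.
  apply: trunc3P; rewrite ?tcoefM0 ?tcoefM1 ?tcoefM2 !sym_lift_coefE
    ?tcoefM0 ?tcoefM1 ?tcoefM2 //.
    by rewrite (vfieldM vDij) //; ring.
  by rewrite (jetM jE) // (vfieldD vDij) // !(vfieldM vDij) //; ring.
- have DcA f : D i j V (c%:A * f) = c%:A * D i j V f.
    by rewrite !mulr_algl (vfieldZ vDij).
  apply: trunc3P; rewrite tcoefZ !sym_lift_coefE !tcoefZ //.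
    by rewrite DcA; ring.
  have -> : symE i j (c%:A * tcoef p 0) = c%:A * symE i j (tcoef p 0).
    by rewrite !mulr_algl (jetZ jE).
  by rewrite !DcA; ring.
- exact: sym_lift_coef0.
- apply: trunc3P; rewrite tcoef_tres // !sym_lift_coefE !tcoef_tres //.
    by rewrite aresD // aresM // (vfield_res vDij) // (tra_section atl sV sW).
  rewrite 3?aresD // !aresM // (jet_res jE) // (vfield_res vDij) //.
  by rewrite (tra_section atl sV sW) (trb_section atl sV sW).
Qed.

Variables (F : modSheaf O) (mt : forall V : set X, vfield O -> tL Y V -> tL Y V -> F V).
Hypothesis tri : trilinear mt.

(** Two formulas for the same vector field agree only on the relevant open sets, not as families
    indexed by all sets; a trilinear map respects this weaker equality. *)
Lemma eq_is_cocycle2 (rho rho' : J -> J -> J -> vfield O) :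
  (forall i j k, is_vfield (U i `&` U j `&` U k) (rho i j k)) ->
  (forall i j k, eq_vfield (U i `&` U j `&` U k) (rho i j k) (rho' i j k)) ->
  is_cocycle2 (twist2 mt e rho) -> is_cocycle2 (twist2 mt e rho').
Proof.
move=> vrho erho cP i j k l V sV; rewrite -[RHS](cP i j k l V sV).
have eq3 i' j' k' : osub V (U i' `&` U j' `&` U k') ->
    mres F _ V (twist2 mt e rho' i' j' k') = mres F _ V (twist2 mt e rho i' j' k').
  move=> sV'; rewrite !(twist2_res atl tri) //; last first.
    exact: eq_vfieldP (erho _ _ _) (vrho _ _ _).
  have sVT : osub V setT by case: sV.
  apply/esym/(mt_eq tri sVT) => [|W sW f].
    by case: sV' => _ _ sub; apply: is_vfieldS sub (vrho _ _ _).
  by apply: erho; apply: osub_trans sV' sW.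
by rewrite !eq3 //; apply: osub_subset sV _ => x [[[]]].
Qed.

Lemma sym_lift_obstruction_cocycle (phi : J -> J -> taut O 2)
  (u : forall i j, trunc (O (U i `&` U j)) 2) (rho : J -> J -> J -> vfield O)
  (cov : open_cover U) (cP : is_cocycle2 (twist2 mt e rho)) :
  is_cocycleH phi u -> described_by q phi u del e s ->
  (forall i j k, eq_vfield (U i `&` U j `&` U k)
     (jet_obstruction del s symE i j k) (rho i j k)) ->
  obstruction_cocycle q mt (Cocycle2 cov cP).
Proof.
move=> cocU desc erho.
exists J, U, phi, u, del, e, s, sym_lift, rho, cov, cP; split=> //.
- move=> i j; split=> [|V sV]; first exact: sym_lift_inG.
  split=> [p|].
    rewrite -(described_transition cov desc) // (transitionE extq atl) //.
    apply: trunc2P; rewrite tcoef_tcut !sym_lift_coefE !tcoefE /=; by ring.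
  (* The witness lifts u = a + b t to A[t]/(t^3), so that its product with t is a t + b t^2. *)
  exists (tC 3 (a i j V) + tC 3 (b i j V) * tX 3); split.
    apply: trunc3P; rewrite !sym_lift_coefE !tcoefE /=;
      rewrite ?(vfield0 (@vD i j)) //; try by ring.
    rewrite (jet0 (symE_jet i j)) //.
    by rewrite (vfield1 (@vD i j)) //; ring.
  rewrite -(described_frame_change cov desc) //.
  by apply: trunc2P; rewrite !tcoefE /= /tra /trb; ring.
- by move=> i j V sV p; apply: sym_liftK.
- move=> i j k; have vJ := jet_obstruction_vfield extq atl symE_jet (i:=i) (j:=j) (k:=k).
  split; first exact: eq_vfieldP (erho i j k) vJ.
  move=> V sV; have [sij sjk sik] := trans_sub sV.
  have sV' : osub V (U k `&` U i) by rewrite setIC.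
  (* [sym_lift_trans] is applied to g_ki(p), which has the constant term of p, and g_ik g_ki = 1. *)
  have gE p : sym_lift i j V (sym_lift j k V (sym_lift k i V p)) =
      p + tC 3 (rho i j k V (tcoef p 0)) * (tX 3 * tX 3).
    by rewrite sym_lift_trans // sym_liftK // sym_lift_coef0 erho.
  split=> [f|]; rewrite gE.
    apply: trunc3P; rewrite expr2 !tcoefE /=; ring.
  rewrite tcoef_tX /= -erho //.
  rewrite (vfield0 vJ sV).
  by apply: trunc3P; rewrite !tcoefE /=; ring.
Qed.

End SymmetricLift.

Theorem theorem7p3p1 (R : realType) (X : topologicalType) (O : algSheaf R[i] X)
    (smX : smooth_projective_variety O)
    (X2 : thickening O) (primX2 : primitive_double X2)
    (LL : modSheaf (tB X2)) (lbLL : line_bundle LL)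
    (q : forall V : set X, LL V -> tL X2 V) (extLL : is_extension q)
    (TL2 : modSheaf O)
    (mt : forall V : set X, vfield O -> tL X2 V -> tL X2 V -> TL2 V)
    (tensTL2 : is_tensorTL2 mt)
    (I : Type) (U : I -> set X) (covU : open_cover U)
    (affU : forall i, affine_open O (U i))
    (D : I -> I -> vfield O)
    (derD : forall i j, is_vfield (U i `&` U j) (D i j))
    (alpha beta : forall i j, O (U i `&` U j))
    (unit_alpha : forall i j, alpha i j \is a GRing.unit)
    (del : I -> forall V : set X, trunc (O V) 2 -> tB X2 V)
    (e : forall i, tL X2 (U i)) (s : forall i, LL (U i))
    (phi := fun i j => Phi (D i j) (alpha i j))
    (u := fun i j => tC 2 (alpha i j) + beta i j *: tX 2)
    (cocU : is_cocycleH phi u)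
    (descU : described_by q phi u del e s) :
  let rho := fun i j k (V : set X) (f : O V) =>
    let a_ij := ares O (U i `&` U j) V (alpha i j) in
    let a_jk := ares O (U j `&` U k) V (alpha j k) in
    let b_ij := ares O (U i `&` U j) V (beta i j) in
    let b_jk := ares O (U j `&` U k) V (beta j k) in
    (2%:R^-1 : R[i]) *:
      (b_ij * D j k V f
       + (D j k V a_ij + a_ij / a_jk * D j k V a_jk - a_ij / a_jk * b_jk) * D i j V f
       + a_ij * (D i j V (D j k V f) - D j k V (D i j V f))) in
  [/\ forall i j k, is_vfield (U i `&` U j `&` U k) (rho i j k),
      forall i j k l V, osub V (U i `&` U j `&` U k `&` U l) -> forall f,
        ares O (U i `&` U j) V (alpha i j) ^+ 2 * rho j k l V f
          - rho i k l V f + rho i j l V f - rho i j k V f = 0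
    & exists rhoP : is_cocycle2 (twist2 mt e rho),
        Delta2 q mt = H2class (Cocycle2 covU rhoP)].
Proof.
move=> rho.
have char2 : 2%:R != 0 :> R[i] by rewrite Num.Theory.pnatr_eq0.
have atl := described_atlas covU descU.
have [tri _] := tensTL2.
(* The coefficients extracted from the atlas are the given D_ij, alpha_ij and beta_ij, restricted to
   V. *)
have eD i j V f : osub V (U i `&` U j) -> trD del i j V f = D i j V f.
  move=> sV; rewrite /trD (described_transition covU descU) //.
  by rewrite !tcoefE /=; ring.
have ea i j V : osub V (U i `&` U j) ->
    tra del s i j V = ares O (U i `&` U j) V (alpha i j).
  move=> sV; rewrite /tra (described_frame_change covU descU) // tcoef_tres //.
    by congr ares; rewrite !tcoefE /=; ring.
  by apply: openI; apply: covU.1.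
have eb i j V : osub V (U i `&` U j) ->
    trb del s i j V = ares O (U i `&` U j) V (beta i j).
  move=> sV; rewrite /trb (described_frame_change covU descU) // tcoef_tres //.
    by congr ares; rewrite !tcoefE /=; ring.
  by apply: openI; apply: covU.1.
have jE := symE_jet char2 atl.
have vJ := jet_obstruction_vfield extLL atl jE.
have erho i j k : eq_vfield (U i `&` U j `&` U k)
    (jet_obstruction del s (symE del s) i j k) (rho i j k).
  move=> V sV f; have [sij sjk _] := trans_sub sV.
  rewrite (symE_obstruction char2 extLL atl) // /rho /trc !(eD j k) // !(eD i j) //.
  rewrite !ea // !eb //; congr (_ *: _).
  (* Once c_jk is expanded, the identity is polynomial in the inverse of alpha_jk, which may
     therefore be treated as a variable. *)
  by move: (ares _ (_ `&` _) _ (alpha j k))^-1 => x; ring.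
have rhoP : is_cocycle2 (twist2 mt e rho).
  apply: (eq_is_cocycle2 atl tri vJ erho).
  exact: (jet_obstruction_is_cocycle2 extLL atl jE tri).
have obs : obstruction_cocycle q mt (Cocycle2 covU rhoP).
  exact: sym_lift_obstruction_cocycle cocU descU erho.
split.
- by move=> i j k; apply: eq_vfieldP (erho i j k) (vJ i j k).
- move=> i j k l V sV f.
  rewrite -[RHS](jet_obstruction_cocycle extLL atl (symE del s) sV f).
  have sub3 i' j' k' : U i `&` U j `&` U k `&` U l `<=` U i' `&` U j' `&` U k' ->
      osub V (U i' `&` U j' `&` U k').
    exact: osub_subset sV.
  rewrite -ea; last by apply: osub_subset sV _ => x [[[]]].
  by rewrite !erho //; apply: sub3 => x [[[]]].
(* One inclusion is uniqueness of the class of obstruction cocycles; the other holds because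
   (rho_ijk) is itself an obstruction cocycle. *)
exists rhoP; apply/seteqP; split=> [d [c obsc cd]|d cd].
  exact: rst_trans (obstruction_cocycle_unique extLL tri char2 obs obsc) cd.
by exists (Cocycle2 covU rhoP).
Qed.
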